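(* Consider an algorithm that, given an input instance of the Longest Common Factor problem taking $\mathcal{O}(u)$ bits, runs in time $T_{\rm LCF}(u)$ and uses working space $S_{\rm LCF}(u)$. Let $T \in \{0,1\}^{n}$ be a nonempty text and let $\mathcal{D} = \{P_1, \dots, P_k\} \subseteq \{0,1\}^{m}$ be a set of $k = \Theta(n/\log n)$ nonempty patterns of common length $m = \Theta(\log n)$. Then, given the packed representations of $T$ and of all patterns in $\mathcal{D}$, one can decide whether there exists $i \in [1 \mathinner{.\,.} k]$ such that $P_i$ occurs in $T$ in $\mathcal{O}(T_{\rm LCF}(n))$ time and $\mathcal{O}(S_{\rm LCF}(n))$ working space.
   Context: Model: word RAM with words of $w \ge \log(\text{input size})$ bits; packed representation of a length-$n$ string over $[0\mathinner{.\,.}\sigma)$ stores $\Theta(\log_\sigma n)$ symbols per word. $\mathrm{LCF}(S_1,S_2)$ denotes the length of a longest string that is a substring (contiguous factor) of both $S_1$ and $S_2$. Longest Common Factor problem: given the packed representations of $S_1\in\{0,1\}^{n_1}$ and $S_2\in\{0,1\}^{n_2}$, output $\mathrm{LCF}(S_1,S_2)$. *)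

(* Defs.v *)
From mathcomp Require Import all_boot.

Set Implicit Arguments.
Unset Strict Implicit.
Unset Printing Implicit Defensive.

(* Number of binary digits of n (for n > 0).  It is log_2 n up to a constant
   factor for n >= 2, and stays positive for n <= 1. *)
Definition lg (n : nat) : nat := (trunc_log 2 n).+1.

(* f and g are within the multiplicative constant a of each other; a Theta
   relation is this predicate for a constant a fixed before all sizes. *)
Definition within_factor (a f g : nat) : Prop := f <= a * g /\ g <= a * f.

(* Word RAM.  A w-bit word is a natural number below 2 ^ w.  A program uses
   finitely many registers (those it names) and a memory addressed by words.
   Control flow is structured, which costs only a constant factor compared
   with jumps. *)

Inductive binop : Type :=
  | Add | Sub | Mul | Div | Mod | And | Or | Xor | Shl | Shr | Ltn | Eqn.

(* All results are reduced modulo 2 ^ w; Div by 0 yields 0 and Mod by 0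
   yields the first operand. *)
Definition binop_eval (w : nat) (o : binop) (x y : nat) : nat :=
  match o with
  | Add => (x + y) %% 2 ^ w
  | Sub => if y <= x then (x - y) %% 2 ^ w else (x + 2 ^ w - y) %% 2 ^ w
  | Mul => (x * y) %% 2 ^ w
  | Div => (x %/ y) %% 2 ^ w
  | Mod => (x %% y) %% 2 ^ w
  | And => Nat.land x y %% 2 ^ w
  | Or => Nat.lor x y %% 2 ^ w
  | Xor => Nat.lxor x y %% 2 ^ w
  | Shl => (x * 2 ^ y) %% 2 ^ w
  | Shr => (x %/ 2 ^ y) %% 2 ^ w
  | Ltn => (x < y) %% 2 ^ w
  | Eqn => (x == y) %% 2 ^ w
  end.

(* Registers are named by natural numbers x, y, z. *)
Inductive prog : Type :=
  | Skip
  | Const (x : nat) (c : nat)             (* x := c *)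
  | Op (o : binop) (x y z : nat)          (* x := y o z *)
  | Read (x y : nat)                      (* x := memory[y] *)
  | Write (x y : nat)                     (* memory[x] := y *)
  | Seq (p q : prog)
  | If (x : nat) (p q : prog)             (* p if x <> 0, else q *)
  | While (x : nat) (p : prog).           (* iterate p as long as x <> 0 *)

Record state : Type := State { reg : nat -> nat; mem : nat -> nat }.

Definition upd (f : nat -> nat) (i v : nat) : nat -> nat :=
  fun j => if j == i then v else f j.

Definition set_reg (s : state) (x v : nat) : state :=
  State (upd (reg s) x v) (mem s).

Definition set_mem (s : state) (i v : nat) : state :=
  State (reg s) (upd (mem s) i v).

(* [exec w p s t tr s']: on w-bit words, p started in s halts in s' after t
   elementary steps (each instruction and each test costs 1), and tr lists the
   memory addresses read or written. *)
Inductive exec (w : nat) :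
    prog -> state -> nat -> seq nat -> state -> Prop :=
  | ExecSkip s : exec w Skip s 1 [::] s
  | ExecConst x c s :
      exec w (Const x c) s 1 [::] (set_reg s x (c %% 2 ^ w))
  | ExecOp o x y z s :
      exec w (Op o x y z) s 1 [::]
        (set_reg s x (binop_eval w o (reg s y) (reg s z)))
  | ExecRead x y s :
      exec w (Read x y) s 1 [:: reg s y] (set_reg s x (mem s (reg s y)))
  | ExecWrite x y s :
      exec w (Write x y) s 1 [:: reg s x] (set_mem s (reg s x) (reg s y))
  | ExecSeq p q s1 s2 s3 t1 t2 tr1 tr2 :
      exec w p s1 t1 tr1 s2 -> exec w q s2 t2 tr2 s3 ->
      exec w (Seq p q) s1 (t1 + t2) (tr1 ++ tr2) s3
  | ExecIfT x p q s s' t tr :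
      reg s x <> 0 -> exec w p s t tr s' ->
      exec w (If x p q) s t.+1 tr s'
  | ExecIfF x p q s s' t tr :
      reg s x = 0 -> exec w q s t tr s' ->
      exec w (If x p q) s t.+1 tr s'
  | ExecWhileF x p s :
      reg s x = 0 -> exec w (While x p) s 1 [::] s
  | ExecWhileT x p s1 s2 s3 t1 t2 tr1 tr2 :
      reg s1 x <> 0 -> exec w p s1 t1 tr1 s2 ->
      exec w (While x p) s2 t2 tr2 s3 ->
      exec w (While x p) s1 (t1 + t2).+1 (tr1 ++ tr2) s3.

(* The input words occupy the addresses 0, 1, ...; everything else is 0. *)
Definition init (input : seq nat) : state := State (fun=> 0) (nth 0 input).

(* Length of the shortest prefix of the memory that contains all accessed
   cells; accessed input cells count. *)
Definition space (tr : seq nat) : nat := \max_(i <- tr) i.+1.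

(* The output is the final content of register 0. *)
Definition runs_within (w : nat) (p : prog) (input : seq nat)
    (output time_bound space_bound : nat) : Prop :=
  exists (t : nat) (tr : seq nat) (s : state),
    [/\ exec w p (init input) t tr s,
        reg s 0 = output,
        t <= time_bound
      & space tr <= space_bound].

(* Packed representation with b symbols per word, the first symbol of each
   block in the least significant bit. *)
Definition bits_to_nat (s : seq bool) : nat :=
  foldr (fun (x : bool) v => x + v.*2) 0 s.

Definition pack (b : nat) (s : seq bool) : seq nat :=
  [seq bits_to_nat (take b (drop (i * b) s))
     | i <- iota 0 ((size s + b.-1) %/ b)].

(* Length of a longest common factor; [infix] is the contiguous factor
   relation. *)
Definition LCF (S1 S2 : seq bool) : nat :=
  \max_(l < (size S1).+1 | [exists F : l.-tuple bool, infix F S1 && infix F S2])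
     l.

(* In both problems the number of symbols per word is the logarithm of the
   total number of symbols of the instance. *)
Definition LCF_input (S1 S2 : seq bool) : seq nat :=
  let b := lg (size S1 + size S2) in
  [:: size S1, size S2 & pack b S1 ++ pack b S2].

Definition DM_input (n m k : nat)
    (T : n.-tuple bool) (D : k.-tuple (m.-tuple bool)) : seq nat :=
  let b := lg (n + k * m) in
  [:: n, m, k & pack b T ++ flatten [seq pack b (tval P) | P <- D]].

(* On instances of O(u) bits, A computes LCF(S1, S2) in O(time u) time and
   O(space u) space, on every word size w >= log(input size) + O(1).  The
   first constant c is the one in O(u); C, which depends on it, is hidden in
   the resource bounds. *)
Definition LCF_algorithm (A : prog) (time_fun space_fun : nat -> nat) : Prop :=
  exists d : nat, forall c : nat, exists C : nat,
  forall (u n1 n2 w : nat) (S1 : n1.-tuple bool) (S2 : n2.-tuple bool),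
    0 < u -> n1 + n2 <= c * u -> lg (n1 + n2) + d <= w ->
    runs_within w A (LCF_input S1 S2) (LCF S1 S2)
      (C * time_fun u) (C * space_fun u).

(* Main.v *)
From mathcomp Require Import all_boot zify.
Require Import Defs.

Set Implicit Arguments.
Unset Strict Implicit.
Unset Printing Implicit Defensive.

(* Encode a bit x as 110x0 and a string s as wrap s = phi(s) 11, where phi
   encodes bitwise; take S1 = wrap T 0^14 and S2 = wrap P_1 ... wrap P_k.  In S1
   the factor 111 never occurs and 11 occurs only at the start of a block, while
   every factor of S2 of the length 5m + 2 of a block that is not itself a block
   straddles a boundary 11|11 and so contains 111.  Hence LCF(S1, S2) >= 5m + 2
   iff some P_i occurs in T.  The padding of S1 only ensures that a word holds
   an encoded bit.

   The packed instance is produced in O(1) time per word: a table gives the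
   spread of every chunk of h bits, where h is about a fifth of the word length,
   so that the table has o(n / log n) entries.  The instance is built above the
   input and the table and then moved down to address 0, with all other cells
   cleared, so that the given algorithm runs on exactly the memory it expects.

   The O(n / log n) cost of this reduction is absorbed because an LCF algorithm
   must read all words of 0^n when run on (0^n, 1^n). *)

(** * Reduction of dictionary matching to LCF *)

(** The bounds [T_LCF] and [S_LCF] are arbitrary functions: nothing is known about their growth or
    monotonicity, so every cost has to be charged at the argument n itself. [LCF_algorithm] permits
    this because for each c it covers all instances of up to c u bits at the same u. Both the
    encoded pair, with c = 21 (1 + a a), and the probe pair (0^n, 1^n), with c = 2, are therefore
    run at u = n. For the same reason the lower bound must be extracted from the algorithm: no
    assumption relates n / log n to [T_LCF n]. LCF reports only a length, so a match crossing the
    border of two patterns has to be excluded by the encoding; the pattern 11|11 at each border does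
    this. The number of symbols per word is dictated by the total length of an instance, so input
    and encoded instance use different lengths b and B, and encoded chunks have to be shifted across
    word borders. *)

Lemma leq_LCF l S1 S2 : 0 < l ->
  reflect (exists F, [/\ size F = l, infix F S1 & infix F S2])
          (l <= LCF S1 S2).
Proof.
move=> l_gt0; apply: (iffP idP) => [|[F [sF F1 F2]]].
  case: (boolP [exists i : 'I_(size S1).+1,
      (l <= i) && [exists F : i.-tuple bool, infix F S1 && infix F S2]]).
    case/existsP=> i /andP[li /existsP[F /andP[F1 F2]]] _.
    have FF : infix (take l F) F by apply: prefixW; exact: prefix_take.
    exists (take l F); split; first by rewrite size_take size_tuple; case: ltngtP li.
      exact: infix_trans FF F1.
    exact: infix_trans FF F2.
  rewrite negb_exists => /forallP noF.
  rewrite -[l]prednK // ltnNge => /negP[]; apply/bigmax_leqP => i iP.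
  have := noF i; rewrite iP andbT -ltnNge; by move=> il; rewrite -ltnS prednK.
have lt : l < (size S1).+1 by rewrite ltnS -sF; exact: size_infix.
have P : [exists F : (Ordinal lt).-tuple bool, infix F S1 && infix F S2].
  apply/existsP; have /eqP sF' := sF.
  by exists (Tuple sF'); rewrite F1 F2.
exact: (@leq_bigmax_cond _ (fun i : 'I_(size S1).+1 =>
  [exists F : i.-tuple bool, infix F S1 && infix F S2]) (@nat_of_ord _) _ P).
Qed.

Lemma infix_nthP (F S : seq bool) :
  reflect (exists2 o, o + size F <= size S &
             forall j, j < size F -> nth false F j = nth false S (o + j))
          (infix F S).
Proof.
apply: (iffP (@infixP _ F S)) => [[s [s' ->]]|[o le eqn]].
  exists (size s); first by rewrite !size_cat leq_add2l leq_addr.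
  by move=> j jF; rewrite nth_cat ltnNge leq_addr /= addKn nth_cat jF.
exists (take o S), (drop (o + size F) S).
have -> : F = take (size F) (drop o S).
  apply: (@eq_from_nth _ false) => [|j jF].
    by rewrite size_take size_drop; case: ltnP => //; lia.
  by rewrite nth_take // nth_drop eqn.
have -> : size (take (size F) (drop o S)) = size F.
  by rewrite size_take size_drop; case: ltnP => //; lia.
by rewrite catA addnC -drop_drop -catA cat_take_drop cat_take_drop.
Qed.

(** Both zeros are needed when x = 1: without the first, x would extend its own marker 11 to 111;
    without the second, it would extend the marker of the next block. *)
Definition code (x : bool) : seq bool := [:: true; true; false; x; false].

Definition phi (s : seq bool) : seq bool := flatten [seq code x | x <- s].

Definition wrap (s : seq bool) : seq bool := phi s ++ [:: true; true].

Lemma phi_cat s t : phi (s ++ t) = phi s ++ phi t.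
Proof. by rewrite /phi map_cat flatten_cat. Qed.

Lemma size_phi s : size (phi s) = 5 * size s.
Proof. by elim: s => //= x s IH; rewrite /phi /= -/(phi s) IH; lia. Qed.

Lemma size_wrap s : size (wrap s) = 5 * size s + 2.
Proof. by rewrite size_cat size_phi. Qed.

(** This reduces all window arguments to residues modulo 5. The default [false] makes the formula
    valid at every p and independent of the padding length. *)
Lemma nth_wrap_pad s z p : nth false (wrap s ++ nseq z false) p =
  ((p %% 5 < 2) && (p < 5 * size s + 2)) || ((p %% 5 == 3) && nth false s (p %/ 5)).
Proof.
rewrite /wrap -catA.
elim: s p => [|x s IH] p.
  case: p => [|[|p]] //=; rewrite nth_nseq nth_nil andbF.
  by rewrite !ltnS ltn0 andbF /=; case: ifP.
case: p => [|[|[|[|[|p]]]]]; rewrite /phi /= ?orbF // -/(phi s); first by lia.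
rewrite (IH p : nth false (phi s ++ [:: true, true & nseq z false]) p = _).
have -> : p.+1.+4 = p + 5 by lia.
by rewrite modnDr divnDr // divnn /= addn1; congr (_ || _); congr (_ && _); lia.
Qed.

Lemma nth_wrap s p : nth false (wrap s) p =
  ((p %% 5 < 2) && (p < 5 * size s + 2)) || ((p %% 5 == 3) && nth false s (p %/ 5)).
Proof. by rewrite -(nth_wrap_pad s 0 p) /= cats0. Qed.

Lemma infix_wrap (P T : seq bool) z :
  0 < size P -> infix (wrap P) (wrap T ++ nseq z false) = infix P T.
Proof.
move=> P_gt0; apply/infix_nthP/infix_nthP => [[o le eqn]|[o le eqn]].
  have val j : j < 5 * size P + 2 -> nth false (wrap T ++ nseq z false) (o + j) =
    ((j %% 5 < 2) || ((j %% 5 == 3) && nth false P (j %/ 5))).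
    by move=> jP; rewrite -eqn ?size_wrap // nth_wrap jP andbT.
  (* Bits [o] and [o + 1] are both ones, which in the encoded text happens only at residue 0. *)
  have o5 : o %% 5 = 0.
    have := val 0 ltac:(lia); have := val 1 ltac:(lia).
    rewrite !nth_wrap_pad /= addn0.
    have : (o + 1) %% 5 = if o %% 5 == 4 then 0 else o %% 5 + 1 by case: eqP; lia.
    move=> ->; have : o %% 5 < 5 by rewrite ltn_mod.
    by case: (o %% 5) => [|[|[|[|[|]]]]].
  have oE : o = 5 * (o %/ 5) by lia.
  exists (o %/ 5).
    (* The closing 11 of [wrap P] must meet a marker of the text, and markers stop with [wrap T]; so
       P fits before the end of T. *)
    have := val (5 * size P) ltac:(lia).
    rewrite modnMr /= nth_wrap_pad.
    have -> : (o + 5 * size P) %% 5 = 0 by lia.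
    by rewrite /= orbF => h; lia.
  move=> j jP; have := val (5 * j + 3) ltac:(lia).
  rewrite nth_wrap_pad.
  have -> : (o + (5 * j + 3)) %% 5 = 3 by lia.
  have -> : (5 * j + 3) %% 5 = 3 by lia.
  have -> : (o + (5 * j + 3)) %/ 5 = o %/ 5 + j by lia.
  by have -> /= : (5 * j + 3) %/ 5 = j by lia.
exists (5 * o); first by rewrite size_cat !size_wrap; lia.
move=> j; rewrite size_wrap => jP; rewrite nth_wrap nth_wrap_pad.
have -> : (5 * o + j) %% 5 = j %% 5 by lia.
have -> : (5 * o + j) %/ 5 = o + j %/ 5 by lia.
have -> : (j < 5 * size P + 2) = true by lia.
have -> : (5 * o + j < 5 * size T + 2) = true by lia.
case: (ltnP (j %/ 5) (size P)) => jlt; first by rewrite eqn.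
by have -> : j %% 5 == 3 = false by lia.
Qed.

(** Among three consecutive positions, one has residue 2 or 4 modulo 5, where the bit is always
    0. *)
Lemma no_three_ones s z p :
  ~~ [&& nth false (wrap s ++ nseq z false) p,
         nth false (wrap s ++ nseq z false) p.+1
       & nth false (wrap s ++ nseq z false) p.+2].
Proof.
rewrite !nth_wrap_pad.
have -> : p.+1 %% 5 = if p %% 5 == 4 then 0 else (p %% 5).+1 by case: eqP; lia.
have -> : p.+2 %% 5 = if p %% 5 >= 3 then p %% 5 - 3 else (p %% 5).+2 by case: leqP; lia.
have : p %% 5 < 5 by rewrite ltn_mod.
by case: (p %% 5) => [|[|[|[|[|]]]]] //= _; rewrite ?andbF.
Qed.

Lemma nth_flatten_wrap m (D : seq (seq bool)) i r :
  all (fun P => size P == m) D -> i < size D -> r < 5 * m + 2 ->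
  nth false (flatten [seq wrap P | P <- D]) (i * (5 * m + 2) + r)
  = nth false (wrap (nth [::] D i)) r.
Proof.
move=> /allP sD iD rL.
elim: D i iD sD => //= P D IH [|i] iD sD; have sP := eqP (sD P (mem_head _ _)).
  by rewrite nth_cat size_wrap sP rL.
rewrite nth_cat size_wrap sP ifN; last by rewrite mulSn -leqNgt; lia.
have -> : i.+1 * (5 * m + 2) + r - (5 * m + 2) = i * (5 * m + 2) + r by lia.
by apply: IH => // Q QD; apply: sD; rewrite inE QD orbT.
Qed.

Lemma size_flatten_wrap m (D : seq (seq bool)) :
  all (fun P => size P == m) D ->
  size (flatten [seq wrap P | P <- D]) = size D * (5 * m + 2).
Proof.
elim: D => //= P D IH /andP[/eqP sP sD].
by rewrite size_cat size_wrap sP IH // mulSn.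
Qed.

Lemma LCF_wrap m z (T : seq bool) (D : seq (seq bool)) :
  0 < m -> all (fun P => size P == m) D ->
  (5 * m + 1 < LCF (wrap T ++ nseq z false) (flatten [seq wrap P | P <- D]))
  = has (fun P => infix P T) D.
Proof.
move=> m_gt0 sD; have := sD => /allP sD'.
rewrite -addnS; apply/leq_LCF/hasP => [|[F [sF F1 F2]]|[P PD PT]]; first by lia.
- have := F2 => /infix_nthP [o]; rewrite (size_flatten_wrap sD) sF => ole oE.
  set L := 5 * m + 2 in sF ole oE.
  pose i := o %/ L; pose r := o %% L.
  have rL : r < L by rewrite ltn_mod; lia.
  have oir : o = i * L + r by rewrite -divn_eq.
  have [r0|r_gt0] := posnP r.
    have iD : i < size D by rewrite -(@ltn_pmul2r L); lia.
    exists (nth [::] D i); first exact: mem_nth.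
    have sP := eqP (sD' _ (mem_nth [::] iD)).
    rewrite -(infix_wrap _ z) ?sP //.
    suff -> : wrap (nth [::] D i) = F by [].
    apply: (@eq_from_nth _ false); rewrite size_wrap sP ?sF // => j jL.
    by rewrite oE ?sF // oir r0 addn0 (nth_flatten_wrap sD).
  have iD : i.+1 < size D.
    have L_gt0 : 0 < L by rewrite /L; lia.
    by rewrite -(ltn_pmul2r L_gt0) mulSn; lia.
  have iD' : i < size D by lia.
  have sP := eqP (sD' _ (mem_nth [::] iD)).
  have sP' := eqP (sD' _ (mem_nth [::] iD')).
  have [o1 o1le o1E] := infix_nthP _ _ F1; rewrite sF in o1le o1E.
  have ones j : L <= r + j + 2 -> r + j < L + 2 -> j < L ->
      nth false (wrap T ++ nseq z false) (o1 + j).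
    move=> j1 j2 jL; rewrite -o1E // oE // oir -addnA.
    case: (ltnP (r + j) L) => rj.
      rewrite (nth_flatten_wrap sD) // nth_wrap sP' rj andbT.
      have [->|->] : r + j = 5 * m \/ r + j = 5 * m + 1 by rewrite /L in j1 rj *; lia.
        by rewrite modnMr.
      by rewrite mulnC modnMDl.
    have -> : i * L + (r + j) = i.+1 * L + (r + j - L) by rewrite mulSn; lia.
    rewrite (nth_flatten_wrap sD) //; last by lia.
    rewrite nth_wrap sP; have : r + j - L < 2 by lia.
    by case: (r + j - L) => [|[|]] //= _; rewrite ?addn_gt0 ?addn2 ?ltnS ?orbT.
  (* A window of length [L] at offset 0 < r < L contains either the closing 11 of one block and the
     first bit of the next, or the last bit of one block and the opening 11 of the next. *)
  have [rL2|rL1] : L - r >= 2 \/ L - r = 1 by lia.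
    have /negP[] := no_three_ones T z (o1 + (L - r - 2)); rewrite -!addnS.
    by apply/and3P; split; apply: ones; lia.
  have /negP[] := no_three_ones T z (o1 + 0); rewrite -!addnS.
  by apply/and3P; split; apply: ones; rewrite /L in rL1 *; lia.
- have sP := eqP (sD' P PD).
  exists (wrap P); split; first by rewrite size_wrap sP.
    by rewrite infix_wrap ?sP.
  have [i iD <-] := nthP [::] PD.
  have -> : [seq wrap Q | Q <- D] =
      map wrap (take i D) ++ wrap (nth [::] D i) :: map wrap (drop i.+1 D).
    by rewrite -map_cons -map_cat -(drop_nth [::] iD) cat_take_drop.
  by rewrite flatten_cat /= infix_infix.
Qed.

(** * Packed strings as numbers *)

Lemma lt_lg n : n < 2 ^ lg n.
Proof. exact: trunc_log_ltn. Qed.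

Lemma lg_le n : 0 < n -> 2 ^ (lg n).-1 <= n.
Proof. exact: trunc_logP. Qed.

Lemma lg_double n : 0 < n -> lg (n + n) = (lg n).+1.
Proof. by move=> n0; rewrite addnn /lg trunc_log2_double. Qed.

Lemma leq_lg n e : 0 < e -> n < 2 ^ e -> lg n <= e.
Proof.
move=> e0 ne; case: (posnP n) => [->|n0]; first by rewrite /lg trunc_log0.
by have := leq_ltn_trans (lg_le n0) ne; rewrite ltn_exp2l.
Qed.

(** The exact bit length. Unlike [lg] it vanishes at 0, so it obeys the halving recurrence followed
    by the counting loop. *)
Definition nbits n := if n == 0 then 0 else lg n.

Lemma nbits_half n : 0 < n -> nbits n = (nbits (n %/ 2)).+1.
Proof.
move=> n0; rewrite /nbits gtn_eqF // divn2.
case: (ltnP 1 n) => n1; last by have -> : n = 1 by lia.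
by rewrite /lg trunc_log2S // ifN //; lia.
Qed.

Lemma bits_lt s : bits_to_nat s < 2 ^ size s.
Proof. by elim: s => //= x s IH; rewrite expnS; case: x; lia. Qed.

Lemma bits_cat s t : bits_to_nat (s ++ t) = bits_to_nat s + bits_to_nat t * 2 ^ size s.
Proof.
elim: s => [|x s IH] /=; first by rewrite muln1.
by rewrite IH expnS; lia.
Qed.

Lemma bits_nseq n : bits_to_nat (nseq n false) = 0.
Proof. by elim: n => //= n ->. Qed.

Lemma bits_take l s : bits_to_nat (take l s) = bits_to_nat s %% 2 ^ l.
Proof.
case: (leqP (size s) l) => sl.
  by rewrite take_oversize // modn_small // (leq_trans (bits_lt s)) ?leq_exp2l.
rewrite -{2}(cat_take_drop l s) bits_cat size_takel 1?ltnW //.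
by rewrite addnC modnMDl modn_small // -[in X in _ < X](@size_takel l _ s) ?bits_lt // ltnW.
Qed.

Lemma bits_drop l s : bits_to_nat (drop l s) = bits_to_nat s %/ 2 ^ l.
Proof.
case: (leqP (size s) l) => sl.
  by rewrite drop_oversize // divn_small // (leq_trans (bits_lt s)) ?leq_exp2l.
rewrite -{2}(cat_take_drop l s) bits_cat size_takel 1?ltnW //.
rewrite addnC divnMDl ?expn_gt0 // divn_small ?addn0 //.
by rewrite -[in X in _ < X](@size_takel l _ s) ?bits_lt // ltnW.
Qed.

Lemma size_pack b s : size (pack b s) = (size s + b.-1) %/ b.
Proof. by rewrite size_map size_iota. Qed.

Lemma ceil_drop n b : 0 < b -> 0 < n -> (n + b.-1) %/ b = ((n - b) + b.-1) %/ b + 1.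
Proof.
move=> b0 n0; case: (leqP b n) => bn.
  rewrite (_ : n + b.-1 = 1 * b + (n - b + b.-1)); last by lia.
  by rewrite divnMDl // addnC.
rewrite (_ : n + b.-1 = 1 * b + n.-1); last by lia.
rewrite divnMDl // divn_small; last by lia.
by rewrite divn_small //; lia.
Qed.

Lemma pack_cons b s : 0 < b -> 0 < size s ->
  pack b s = bits_to_nat (take b s) :: pack b (drop b s).
Proof.
move=> b0 s0; rewrite /pack ceil_drop // addn1 /= mul0n drop0 size_drop.
congr (_ :: _); rewrite -[1]addn0 iotaDl -map_comp; apply: eq_map => i /=.
by rewrite drop_drop mulnDl mul1n addnC.
Qed.

(** A packed string is the base 2^b expansion of a single number. No bound on j is needed, since the
    default 0 agrees with the digits past the end; later proofs treat whole streams as numbers. *)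
Lemma nth_pack b s j : 0 < b ->
  nth 0 (pack b s) j = bits_to_nat s %/ 2 ^ (b * j) %% 2 ^ b.
Proof.
move=> b0; case: (ltnP j ((size s + b.-1) %/ b)) => jlt.
  rewrite (nth_map 0) ?size_iota // nth_iota // add0n.
  by rewrite bits_take bits_drop mulnC.
rewrite nth_default ?size_pack // divn_small ?mod0n //.
apply: leq_trans (bits_lt s) _; rewrite leq_exp2l //.
have : size s + b.-1 < (j.+1) * b by rewrite -ltn_divLR.
by rewrite mulSn mulnC; lia.
Qed.

(* Bit i of [y] moves to bit 5 i; the fuel [f] bounds the number of bits. *)
Fixpoint spread f y :=
  if f is f'.+1 then y %% 2 + 32 * spread f' (y %/ 2) else 0.

Lemma spread0 f : spread f 0 = 0.
Proof. by elim: f => //= f ->. Qed.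

(** With enough fuel the same f serves on both sides, so a table entry follows from the entry at
    half its index. *)
Lemma spread_rec f y : y < 2 ^ f -> spread f y = y %% 2 + 32 * spread f (y %/ 2).
Proof.
elim: f y => [|f IH] y yf; first by have -> : y = 0 by move: yf; rewrite expn0; lia.
rewrite [LHS]/=; congr (_ + 32 * _).
have yf' : y %/ 2 < 2 ^ f by rewrite ltn_divLR // mulnC -expnS.
by rewrite [RHS]/= IH.
Qed.

Lemma spread_lt f y : 32 * spread f y < 2 ^ (5 * f) * 32.
Proof.
rewrite mulnC ltn_pmul2r //; elim: f y => //= f IH y.
have := IH (y %/ 2); rewrite mulnS expnD (_ : 2 ^ 5 = 32) //.
by move: (spread _ _) (2 ^ _) => u v uv; have := ltn_pmod y (ltn0Sn 1); lia.
Qed.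

(** The factor 8 moves each payload bit to position 3 of its block of five, disjoint from the
    markers 11 in the other summand. Since only [size s <= f] is required, one table also serves
    chunks shorter than f. *)
Lemma bits_phi f s : size s <= f ->
  8 * spread f (bits_to_nat s) + (2 ^ (5 * size s) - 1) %/ 31 * 3
  = bits_to_nat (phi s).
Proof.
have ones l : (2 ^ (5 * l.+1) - 1) %/ 31 = (2 ^ (5 * l) - 1) %/ 31 * 32 + 1.
  have : (2 ^ (5 * l) - 1) = (2 ^ (5 * l) - 1) %/ 31 * 31.
    apply/eqP; rewrite eq_sym; apply/eqP; apply: divnK.
    by rewrite expnM subn1 predn_exp dvdn_mulr.
  have -> : 2 ^ (5 * l.+1) = 32 * 2 ^ (5 * l) by rewrite (mulnS 5 l) expnD.
  have : 0 < 2 ^ (5 * l) by rewrite expn_gt0.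
  by move: (2 ^ _) => u u0 E; lia.
elim: s f => [|x s IH] [|f] //; first by rewrite /= spread0.
rewrite ltnS => sf.
rewrite [size _]/= ones /phi [bits_to_nat (flatten _)]/= -/(phi s) -(IH f) //=.
have -> : (x + (bits_to_nat s).*2) %/ 2 = bits_to_nat s by case: x; lia.
have -> : (x + (bits_to_nat s).*2) %% 2 = x by case: x; lia.
by move: (_ %/ 31) (spread _ _) => u v; case: x; lia.
Qed.

Lemma ltn_pair x y z u : u < x -> z < y -> z + u * y < x * y.
Proof.
move=> ux zy; have : u.+1 * y <= x * y by rewrite leq_mul2r ux orbT.
by rewrite mulSn; lia.
Qed.

(** * Appending a block of at most B bits to a number given by its base 2^B digits *)

Section Digits.

Variables (B V v p l : nat).
Hypotheses (B0 : 0 < B) (VP : V < 2 ^ p) (lB : l <= B) (vl : v < 2 ^ l).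

Local Notation digit U j := (U %/ 2 ^ (B * j) %% 2 ^ B).
Local Notation V' := (V + v * 2 ^ p).
Local Notation q := (p %/ B).
Local Notation r := (p %% B).

Let pE : p = B * q + r.
Proof. by rewrite mulnC -divn_eq. Qed.

Let rB : r < B. Proof. by rewrite ltn_mod. Qed.

Lemma digit_partial : digit V q < 2 ^ r /\ digit V q = V %/ 2 ^ (B * q).
Proof.
have h : V %/ 2 ^ (B * q) < 2 ^ r.
  by rewrite ltn_divLR ?expn_gt0 // -expnD addnC -pE.
rewrite modn_small //.
by apply: leq_trans h _; rewrite leq_exp2l // ltnW.
Qed.

Let emit_div : V' %/ 2 ^ (B * q) = v * 2 ^ r + V %/ 2 ^ (B * q).
Proof.
have -> : V' = v * 2 ^ r * 2 ^ (B * q) + V.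
  by rewrite {1}pE -mulnA -expnD [r + _]addnC addnC.
by rewrite divnMDl ?expn_gt0.
Qed.

(** The current digit has its low r bits in use; the low B - r bits of v fill the rest without a
    carry. *)
Lemma digit_emit0 : digit V' q = digit V q + v %% 2 ^ (B - r) * 2 ^ r.
Proof.
have [h hE] := digit_partial; rewrite hE in h *.
rewrite emit_div.
have BE : 2 ^ B = 2 ^ (B - r) * 2 ^ r by rewrite -expnD subnK // ltnW.
rewrite {1}(divn_eq v (2 ^ (B - r))) mulnDl -mulnA -BE -addnA modnMDl.
rewrite modn_small; first by rewrite addnC.
by rewrite BE addnC ltn_pair // ltn_mod expn_gt0.
Qed.

(** What does not fit spills into the next digit, previously 0. As l <= B it reaches no further, so
    rewriting two cells always suffices. *)
Lemma digit_emit1 : digit V' q.+1 = v %/ 2 ^ (B - r).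
Proof.
have h : v %/ 2 ^ (B - r) < 2 ^ B.
  apply: leq_ltn_trans (leq_div _ _) _.
  by apply: leq_trans vl _; rewrite leq_exp2l.
have [V1 V2] := digit_partial; rewrite V2 in V1.
rewrite -[RHS](modn_small h); congr (_ %% _).
have -> : 2 ^ (B * q.+1) = 2 ^ (B * q) * (2 ^ r * 2 ^ (B - r)).
  by rewrite -!expnD; congr (2 ^ _); rewrite mulnS; lia.
rewrite divnMA emit_div.
by rewrite divnMA divnMDl ?expn_gt0 // (divn_small V1) addn0.
Qed.

Lemma digit_emit j : j != q -> j != q.+1 -> digit V' j = digit V j.
Proof.
move=> jq jq1; case: (ltnP j q) => lt.
  have -> : p = B * j + (B + (p - B * j.+1)).
    have : B * j.+1 <= B * q by rewrite leq_mul2l lt orbT.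
    by rewrite {2}pE mulnS; lia.
  rewrite !expnD (_ : v * _ = v * 2 ^ (p - B * j.+1) * 2 ^ B * 2 ^ (B * j)); last by lia.
  by rewrite addnC divnMDl ?expn_gt0 // modnMDl.
have le : p + B <= B * j.
  have : B * q.+2 <= B * j by rewrite leq_mul2l; apply/orP; right; lia.
  by rewrite {2}pE !mulnS; lia.
rewrite !divn_small //; last first.
  apply: leq_trans (_ : 2 ^ (p + B) <= _); last by rewrite leq_exp2l.
  have v1 : v < 2 ^ B by apply: leq_trans vl _; rewrite leq_exp2l.
  by rewrite addnC expnD mulnC addnC [2 ^ p * 2 ^ B]mulnC [2 ^ p * v]mulnC ltn_pair.
by apply: leq_trans VP _; rewrite leq_exp2l //; lia.
Qed.

End Digits.

(** * Execution and a program logic for the word RAM *)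

Lemma exec_det w p s t1 tr1 s1 t2 tr2 s2 :
  exec w p s t1 tr1 s1 -> exec w p s t2 tr2 s2 -> t1 = t2 /\ s1 = s2.
Proof.
move=> e1; elim: e1 t2 tr2 s2 => {p s t1 tr1 s1}.
- by move=> s t2 tr2 s2 e2; inversion e2.
- by move=> x c s t2 tr2 s2 e2; inversion e2.
- by move=> o x y z s t2 tr2 s2 e2; inversion e2.
- by move=> x y s t2 tr2 s2 e2; inversion e2.
- by move=> x y s t2 tr2 s2 e2; inversion e2.
- move=> p q s1 s2 s3 t1 t2 tr1 tr2 _ IHp _ IHq t tr s e2.
  inversion_clear e2 as [| | | | |? ? ? s' ? ? ? ? ? ep eq| | | |].
  have [? ?] := IHp _ _ _ ep; subst.
  by have [? ?] := IHq _ _ _ eq; subst.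
- move=> x p q s s' t tr xN0 _ IH t2 tr2 s2 e2; inversion e2; subst => //.
  by have [-> ->] := IH _ _ _ ltac:(eassumption).
- move=> x p q s s' t tr x0 _ IH t2 tr2 s2 e2; inversion e2; subst => //.
  by have [-> ->] := IH _ _ _ ltac:(eassumption).
- by move=> x p s x0 t2 tr2 s2 e2; inversion e2; subst.
- move=> x p s1 s2 s3 t1 t2 tr1 tr2 xN0 _ IHp _ IHq t tr s e2.
  inversion e2 as [| | | | | | | | |? ? ? s' ? ? ? ? ? ? ep eq]; subst => //.
  have [? ?] := IHp _ _ _ ep; subst.
  by have [? ?] := IHq _ _ _ eq; subst.
Qed.

(** A step touches at most one cell. Hence counting distinct accessed cells bounds the time from
    below. *)
Lemma exec_size_trace w p s t tr s' : exec w p s t tr s' -> size tr <= t.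
Proof. by elim=> //= *; rewrite ?size_cat; lia. Qed.

Fixpoint regs_below (R : nat) (p : prog) : bool :=
  match p with
  | Skip => true
  | Const x _ => x < R
  | Op _ x y z => [&& x < R, y < R & z < R]
  | Read x y | Write x y => (x < R) && (y < R)
  | Seq p q => regs_below R p && regs_below R q
  | If x p q => [&& x < R, regs_below R p & regs_below R q]
  | While x p => (x < R) && regs_below R p
  end.

Lemma regs_below_leq R R' p : R <= R' -> regs_below R p -> regs_below R' p.
Proof.
move=> RR'; have lt x : x < R -> x < R' by move=> h; apply: leq_trans h RR'.
elim: p => //=.
- by move=> x _; apply: lt.
- by move=> _ x y z /and3P[/lt-> /lt-> /lt->].
- by move=> x y /andP[/lt-> /lt->].
- by move=> x y /andP[/lt-> /lt->].
- by move=> p IHp q IHq /andP[/IHp-> /IHq->].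
- by move=> x p IHp q IHq /and3P[/lt-> /IHp-> /IHq->].
- by move=> x p IHp /andP[/lt-> /IHp->].
Qed.

Lemma regs_below_exists p : exists R, regs_below R p.
Proof.
elim: p => /=.
- by exists 0.
- by move=> x _; exists x.+1.
- by move=> _ x y z; exists (x + y + z).+1; lia.
- by move=> x y; exists (x + y).+1; lia.
- by move=> x y; exists (x + y).+1; lia.
- move=> p [R1 h1] q [R2 h2]; exists (R1 + R2).
  by rewrite (regs_below_leq (leq_addr _ _) h1) (regs_below_leq (leq_addl _ _) h2).
- move=> x p [R1 h1] q [R2 h2]; exists (x.+1 + (R1 + R2)).
  rewrite (regs_below_leq (leq_addl _ _) (regs_below_leq (leq_addr _ _) h1)).
  by rewrite (regs_below_leq (leq_addl _ _) (regs_below_leq (leq_addl _ _) h2)); lia.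
- move=> x p [R1 h1]; exists (x.+1 + R1).
  by rewrite (regs_below_leq (leq_addl _ _) h1); lia.
Qed.

(** A run depends only on the named registers and the accessed cells. This lets the given algorithm
    start after [build] instead of from [init], and shows that it cannot react to a cell it never
    accesses. The memory conclusion is stated cell by cell so that it composes along [Seq]: the
    second half may access cells that the first did not. *)
Lemma exec_local w p s t tr s' R S :
  exec w p s t tr s' -> regs_below R p ->
  (forall i, i < R -> reg S i = reg s i) ->
  (forall a, a \in tr -> mem S a = mem s a) ->
  exists S', [/\ exec w p S t tr S',
    forall i, i < R -> reg S' i = reg s' i,
    forall i, R <= i -> reg S' i = reg S i
    & forall a, mem S a = mem s a -> mem S' a = mem s' a].
Proof.
move=> e; elim: e S => {p s t tr s'}.
- by move=> s S _ rS mS; exists S; split => //; constructor.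
- move=> x c s S /= xR rS mS; exists (set_reg S x (c %% 2 ^ w)).
  split=> //= [|i iR|i iR]; first by constructor.
    by rewrite /upd; case: eqP => // _; apply: rS.
  by rewrite /upd ifN //; apply: contraTneq iR => ->; rewrite -ltnNge.
- move=> o x y z s S /= /and3P[xR yR zR] rS mS.
  exists (set_reg S x (binop_eval w o (reg S y) (reg S z))).
  split=> //= [|i iR|i iR]; first by constructor.
    by rewrite /upd !rS.
  by rewrite /upd ifN //; apply: contraTneq iR => ->; rewrite -ltnNge.
- move=> x y s S /= /andP[xR yR] rS mS; exists (set_reg S x (mem S (reg S y))).
  split=> //= [|i iR|i iR]; first by rewrite -(rS y yR); constructor.
    by rewrite /upd rS // rS // mS ?inE.
  by rewrite /upd ifN //; apply: contraTneq iR => ->; rewrite -ltnNge.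
- move=> x y s S /= /andP[xR yR] rS mS; exists (set_mem S (reg S x) (reg S y)).
  split=> //= [|a aE]; first by rewrite -(rS x xR); constructor.
  by rewrite /upd !rS // aE.
- move=> p q s1 s2 s3 t1 t2 tr1 tr2 _ IHp _ IHq S /= /andP[pR qR] rS mS.
  have [a ain|S1 [e1 r1 r1' m1]] := IHp S pR rS; first by rewrite mS // mem_cat ain.
  have [a ain|S2 [e2 r2 r2' m2]] := IHq S1 qR r1.
    by apply: m1; rewrite mS // mem_cat ain orbT.
  exists S2; split=> // [|i iR|a aE]; first by apply: ExecSeq e1 e2.
    by rewrite r2' // r1'.
  by apply: m2; apply: m1.
- move=> x p q s s' t tr xN0 _ IH S /= /and3P[xR pR qR] rS mS.
  have [S1 [e1 r1 r1' m1]] := IH S pR rS mS.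
  by exists S1; split=> //; apply: ExecIfT => //; rewrite rS.
- move=> x p q s s' t tr x0 _ IH S /= /and3P[xR pR qR] rS mS.
  have [S1 [e1 r1 r1' m1]] := IH S qR rS mS.
  by exists S1; split=> //; apply: ExecIfF => //; rewrite rS.
- move=> x p s x0 S /= /andP[xR pR] rS mS.
  by exists S; split=> //; apply: ExecWhileF; rewrite rS.
- move=> x p s1 s2 s3 t1 t2 tr1 tr2 xN0 _ IHp _ IHq S /= xpR rS mS.
  have /andP[xR pR] := xpR.
  have [a ain|S1 [e1 r1 r1' m1]] := IHp S pR rS; first by rewrite mS // mem_cat ain.
  have [a ain|S2 [e2 r2 r2' m2]] := IHq S1 xpR r1.
    by apply: m1; rewrite mS // mem_cat ain orbT.
  exists S2; split=> // [|i iR|a aE]; first by apply: ExecWhileT e1 e2; rewrite rS.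
    by rewrite r2' // r1'.
  by apply: m2; apply: m1.
Qed.

(* Programs below compile expressions over the registers R, R + 1, ..., which
   the given algorithm does not touch; registers from R + t on are scratch. *)
Inductive expr : Type :=
  | Lit (c : nat)
  | Var (i : nat)
  | Bin (o : binop) (e1 e2 : expr)
  | Mem (e : expr).

Fixpoint compile (R : nat) (e : expr) (d t : nat) : prog :=
  match e with
  | Lit c => Const (R + d) c
  (* There is no move instruction. *)
  | Var i => Seq (Const (R + t) 0) (Op Add (R + d) (R + i) (R + t))
  | Bin o e1 e2 => Seq (compile R e1 t t.+1)
      (Seq (compile R e2 t.+1 t.+2) (Op o (R + d) (R + t) (R + t.+1)))
  | Mem e => Seq (compile R e t t.+1) (Read (R + d) (R + t))
  end.

Fixpoint cost (e : expr) : nat :=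
  match e with
  | Lit _ => 1
  | Var _ => 2
  | Bin _ e1 e2 => cost e1 + (cost e2 + 1)
  | Mem e => cost e + 1
  end.

(** Arithmetic without wrap-around; [no_overflow] is the condition under which the machine agrees
    with it. Operations that the compiled expressions avoid get a dummy value and the condition
    [False]. *)
Definition ideal (o : binop) (x y : nat) : nat :=
  match o with
  | Add => x + y
  | Sub => x - y
  | Mul => x * y
  | Div => x %/ y
  | Mod => x %% y
  | Shl => x * 2 ^ y
  | Ltn => x < y
  | _ => 0
  end.

Definition no_overflow (W : nat) (o : binop) (x y : nat) : Prop :=
  match o with
  | Add => x + y < W
  | Sub => y <= x
  | Mul => x * y < W
  | Div | Mod | Ltn => True
  | Shl => x * 2 ^ y < W
  | _ => False
  end.

Fixpoint eval (rho : seq nat) (m : nat -> nat) (e : expr) : nat :=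
  match e with
  | Lit c => c
  | Var i => nth 0 rho i
  | Bin o e1 e2 => ideal o (eval rho m e1) (eval rho m e2)
  | Mem e => m (eval rho m e)
  end.

(** [W] is the word modulus, and [M] bounds every address read, hence the space. *)
Fixpoint safe (W M : nat) (rho : seq nat) (m : nat -> nat) (e : expr) : Prop :=
  match e with
  | Lit c => c < W
  | Var i => i < size rho /\ nth 0 rho i < W
  | Bin o e1 e2 => [/\ safe W M rho m e1, safe W M rho m e2
      & no_overflow W o (eval rho m e1) (eval rho m e2)]
  | Mem e => [/\ safe W M rho m e, eval rho m e < M & m (eval rho m e) < W]
  end.

Definition holds_regs (R : nat) (rho : seq nat) (r : nat -> nat) : Prop :=
  forall i, i < size rho -> r (R + i) = nth 0 rho i.

(** * Correctness of compiled expressions and rules for timed preconditions *)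

Section Logic.

Variables (w M R : nat).
Hypothesis w_gt0 : 0 < w.
Local Notation W := (2 ^ w).

Let W1 : 1 < W.
Proof. by rewrite -{1}(expn0 2) ltn_exp2l. Qed.

Lemma safe_lt rho m e : safe W M rho m e -> eval rho m e < W.
Proof.
elim: e => //= [i [] //|o e1 IH1 e2 IH2 [/IH1 h1 /IH2 h2]|e IH []] //.
case: o => //=.
- by move=> le; lia.
- by move=> _; apply: leq_ltn_trans (leq_div _ _) h1.
- by move=> _; apply: leq_ltn_trans (leq_mod _ _) h1.
- by move=> _; case: (eval _ _ _ < eval _ _ _); rewrite ?expn_gt0 //; exact: W1.
Qed.

(** Temporaries form a stack starting at [R + t]: the second operand is evaluated strictly above the
    cell holding the first one, so that value survives. *)
Lemma compile_spec e d t rho m r :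
  size rho <= t -> holds_regs R rho r -> safe W M rho m e ->
  exists tr r', [/\ exec w (compile R e d t) (State r m) (cost e) tr (State r' m),
    all (fun a => a < M) tr, r' (R + d) = eval rho m e
    & forall i, i != R + d -> i < R + t -> r' i = r i].
Proof.
move=> rt hr; elim: e d t r rt hr => [c|i|o e1 IH1 e2 IH2|e IH] d t r rt hr /=.
- move=> cW; exists [::], (upd r (R + d) (c %% W)); split=> //=.
  + exact: (ExecConst _ _ _ (State r m)).
  + by rewrite /upd eqxx modn_small.
  + by move=> i id _; rewrite /upd (negPf id).
- move=> [ir iW]; exists [::]; pose r1 := upd r (R + t) (0 %% W).
  exists (upd r1 (R + d) ((r1 (R + i) + r1 (R + t)) %% W)).
  have it : i < t by apply: leq_trans ir rt.
  split=> //=.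
  + apply: (ExecSeq (t1 := 1) (t2 := 1) (tr1 := [::]) (s2 := State r1 m)).
      exact: (ExecConst _ _ _ (State r m)).
    exact: (ExecOp _ Add _ _ _ (State r1 m)).
  + rewrite /upd eqxx /r1 /upd eqn_add2l (ltn_eqF it) eqxx mod0n addn0.
    by rewrite hr // modn_small.
  + by move=> j jd jt; rewrite /upd (negPf jd) /r1 /upd (ltn_eqF jt).
- move=> [h1 h2 ho].
  have [tr1 [r1 [e1E a1 v1 f1]]] := IH1 t t.+1 r ltac:(lia) hr h1.
  have hr1 : holds_regs R rho r1.
    by move=> i ir; rewrite f1 ?hr ?eqn_add2l ?ltn_add2l //; lia.
  have [tr2 [r2 [e2E a2 v2 f2]]] := IH2 t.+1 t.+2 r1 ltac:(lia) hr1 h2.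
  have [lt1 lt2] := (safe_lt h1, safe_lt h2).
  have v12 : r2 (R + t) = eval rho m e1.
    by rewrite f2 // ?eqn_add2l ?ltn_add2l //; lia.
  exists (tr1 ++ (tr2 ++ [::])).
  exists (upd r2 (R + d) (binop_eval w o (r2 (R + t)) (r2 (R + t.+1)))).
  split.
  + apply: ExecSeq e1E _; apply: ExecSeq e2E _.
    exact: (ExecOp _ o _ _ _ (State r2 m)).
  + by rewrite cats0 all_cat a1.
  + rewrite /upd eqxx v12 v2.
    case: o ho => //= ho; try rewrite ho; rewrite modn_small //.
    * by apply: leq_ltn_trans (leq_subr _ _) lt1.
    * by apply: leq_ltn_trans (leq_div _ _) lt1.
    * by apply: leq_ltn_trans (leq_mod _ _) lt1.
    * by case: (eval _ _ _ < eval _ _ _); rewrite ?expn_gt0 //; exact: W1.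
  + move=> i id it; rewrite /upd (negPf id) f2 ?f1 //; try lia.
- move=> [h aM vW].
  have [tr1 [r1 [e1E a1 v1 f1]]] := IH t t.+1 r ltac:(lia) hr h.
  exists (tr1 ++ [:: r1 (R + t)]), (upd r1 (R + d) (m (r1 (R + t)))); split.
  + apply: ExecSeq e1E _; exact: (ExecRead _ _ _ (State r1 m)).
  + by rewrite all_cat a1 /= v1 aM.
  + by rewrite /upd eqxx v1.
  + move=> i id it; rewrite /upd (negPf id) f1 //; lia.
Qed.

(* [c] is a ghost clock: the postcondition receives it advanced by the running time. *)
Definition wp (p : prog) (c : nat) (rho : seq nat) (m : nat -> nat)
    (Q : nat -> seq nat -> (nat -> nat) -> Prop) : Prop :=
  forall r, holds_regs R rho r ->
  exists t tr r' rho' m', [/\ exec w p (State r m) t tr (State r' m'),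
    all (fun a => a < M) tr, holds_regs R rho' r',
    forall i, i < R -> r' i = r i & Q (c + t) rho' m'].

(** The program variables occupy the twenty registers below this offset. *)
Definition scratch := 20.

Definition Asg (x : nat) (e : expr) : prog := compile R e x scratch.

Definition Sto (e1 e2 : expr) : prog :=
  Seq (compile R e1 scratch scratch.+1)
    (Seq (compile R e2 scratch.+1 scratch.+2) (Write (R + scratch) (R + scratch.+1))).

Lemma wp_asg x e c rho m (Q : nat -> seq nat -> (nat -> nat) -> Prop) :
  size rho = scratch -> x < scratch -> safe W M rho m e ->
  Q (c + cost e) (set_nth 0 rho x (eval rho m e)) m -> wp (Asg x e) c rho m Q.
Proof.
move=> rs xs se q r hr.
have [tr [r' [ex a v f]]] := @compile_spec e x scratch rho m r ltac:(lia) hr se.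
exists (cost e), tr, r', (set_nth 0 rho x (eval rho m e)), m; split=> //.
  move=> i; rewrite size_set_nth rs (maxn_idPr xs) => ix.
  rewrite nth_set_nth /=; case: (eqVneq i x) => [->//|ix'].
  by rewrite f ?eqn_add2l ?ltn_add2l // hr // rs.
by move=> i iR; apply: f; lia.
Qed.

Lemma wp_sto e1 e2 c rho m (Q : nat -> seq nat -> (nat -> nat) -> Prop) :
  size rho = scratch -> safe W M rho m e1 -> safe W M rho m e2 -> eval rho m e1 < M ->
  Q (c + (cost e1 + (cost e2 + 1))) rho (upd m (eval rho m e1) (eval rho m e2)) ->
  wp (Sto e1 e2) c rho m Q.
Proof.
move=> rs s1 s2 aM q r hr.
have [tr1 [r1 [ex1 a1 v1 f1]]] := @compile_spec e1 scratch scratch.+1 rho m r ltac:(lia) hr s1.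
have hr1 : holds_regs R rho r1.
  by move=> i ir; rewrite f1 ?hr ?eqn_add2l ?ltn_add2l //; lia.
have [tr2 [r2 [ex2 a2 v2 f2]]] := @compile_spec e2 scratch.+1 scratch.+2 rho m r1 ltac:(lia) hr1 s2.
have v12 : r2 (R + scratch) = eval rho m e1.
  by rewrite f2 // ?eqn_add2l ?ltn_add2l //; lia.
exists (cost e1 + (cost e2 + 1)), (tr1 ++ (tr2 ++ [:: r2 (R + scratch)])), r2, rho.
exists (upd m (r2 (R + scratch)) (r2 (R + scratch.+1))); split.
- apply: ExecSeq ex1 _; apply: ExecSeq ex2 _.
  exact: (ExecWrite _ _ _ (State r2 m)).
- by rewrite !all_cat a1 a2 /= v12 aM.
- by move=> i ir; rewrite f2 ?hr1 ?eqn_add2l ?ltn_add2l //; lia.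
- by move=> i iR; rewrite f2 ?f1 //; lia.
- by rewrite v12 v2.
Qed.

Lemma wp_seq p q c rho m Q :
  wp p c rho m (fun c' rho' m' => wp q c' rho' m' Q) -> wp (Seq p q) c rho m Q.
Proof.
move=> h r hr; have [t1 [tr1 [r1 [rho1 [m1 [ex1 a1 h1 f1 q1]]]]]] := h r hr.
have [t2 [tr2 [r2 [rho2 [m2 [ex2 a2 h2 f2 q2]]]]]] := q1 r1 h1.
exists (t1 + t2), (tr1 ++ tr2), r2, rho2, m2; split=> //.
- exact: ExecSeq ex1 ex2.
- by rewrite all_cat a1.
- by move=> i iR; rewrite f2 // f1.
- by rewrite addnA.
Qed.

Lemma wp_mono p c rho m (Q Q' : nat -> seq nat -> (nat -> nat) -> Prop) :
  wp p c rho m Q -> (forall c' rho' m', Q c' rho' m' -> Q' c' rho' m') ->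
  wp p c rho m Q'.
Proof.
move=> h QQ' r hr; have [t [tr [r' [rho' [m' [ex a h' f q]]]]]] := h r hr.
by exists t, tr, r', rho', m'; split=> //; apply: QQ'.
Qed.

(** The index of [I] is a variant that must decrease, and the clock is an argument of [I], so
    running time is bounded by an invariant acting as a potential. Each successor on the clock pays
    for one loop test, including the last, failing one. *)
Lemma wp_while x p (I : nat -> nat -> seq nat -> (nat -> nat) -> Prop) j c rho m :
  (forall j c rho m, I j c rho m -> x < size rho) ->
  (forall j c rho m, I j c rho m -> nth 0 rho x != 0 ->
     exists2 i, i < j & wp p c.+1 rho m (I i)) ->
  I j c rho m ->
  wp (While (R + x) p) c rho m
    (fun c' rho' m' => nth 0 rho' x = 0 /\ exists i c0, c' = c0.+1 /\ I i c0 rho' m').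
Proof.
move=> xI step; elim: j {-2}j (leqnn j) c rho m => [|k IH] j jk c rho m hI r hr.
all: have rx := hr _ (xI _ _ _ _ hI).
all: case: (posnP (nth 0 rho x)) => [x0|xN0].
- exists 1, [::], r, rho, m; split=> //; first by apply: ExecWhileF; rewrite /= rx.
  by split=> //; exists j, c; rewrite addn1.
- have [i ij] := step _ _ _ _ hI ltac:(by rewrite -lt0n); lia.
- exists 1, [::], r, rho, m; split=> //; first by apply: ExecWhileF; rewrite /= rx.
  by split=> //; exists j, c; rewrite addn1.
- have [i ij h] := step _ _ _ _ hI ltac:(by rewrite -lt0n).
  have [t1 [tr1 [r1 [rho1 [m1 [ex1 a1 h1 f1 q1]]]]]] := h r hr.
  have [t2 [tr2 [r2 [rho2 [m2 [ex2 a2 h2 f2 q2]]]]]] := IH i ltac:(lia) _ _ _ q1 _ h1.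
  exists (t1 + t2).+1, (tr1 ++ tr2), r2, rho2, m2; split=> //.
  + by apply: ExecWhileT ex1 ex2; rewrite /= rx; lia.
  + by rewrite all_cat a1.
  + by move=> y yR; rewrite f2 // f1.
  + by rewrite (_ : c + (t1 + t2).+1 = c.+1 + t1 + t2) //; lia.
Qed.

End Logic.

(** * Encoding a string word by word *)

Declare Scope expr_scope.
Delimit Scope expr_scope with E.
Notation "x + y" := (Bin Add x y) : expr_scope.
Notation "x - y" := (Bin Sub x y) : expr_scope.
Notation "x * y" := (Bin Mul x y) : expr_scope.
Notation "x %/ y" := (Bin Div x y) : expr_scope.
Notation "x %% y" := (Bin Mod x y) : expr_scope.
Notation "x < y" := (Bin Ltn x y) : expr_scope.
Notation "'pow2' x" := (Bin Shl (Lit 1) x) (at level 10, x at level 9) : expr_scope.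
Bind Scope expr_scope with expr.
Coercion Var : nat >-> expr.

(* Register [i] stands for the machine register [R + i].  The output stream
   starts at the address [rout] and consists of [rpos] bits so far; [rX] is the
   address of the LCF instance under construction; [rword] holds [rlen] unread
   bits, [rl] of which are encoded next; [emit] appends the [ru] bits of [rv]. *)

Notation rn := 0 (only parsing).
Notation rm := 1 (only parsing).
Notation rk := 2 (only parsing).
Notation rb := 3 (only parsing).
Notation rB := 4 (only parsing).
Notation rh := 5 (only parsing).
Notation rtab := 6 (only parsing).
Notation rX := 7 (only parsing).
Notation rout := 8 (only parsing).
Notation rpos := 9 (only parsing).
Notation rsrc := 10 (only parsing).
Notation rrem := 11 (only parsing).
Notation rword := 12 (only parsing).
Notation rlen := 13 (only parsing).
Notation rl := 14 (only parsing).
Notation rv := 15 (only parsing).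
Notation ru := 16 (only parsing).
Notation ry := 17 (only parsing).
Notation rthr := 18 (only parsing).
Notation rcnt := 19 (only parsing).

(** Expressions have no conditional, so the comparison bit acts as a multiplier. *)
Definition min_expr (e1 e2 : expr) : expr :=
  ((e2 < e1) * e2 + (Lit 1 - (e2 < e1)) * e1)%E.

Definition cell : expr := (rout + rpos %/ rB)%E.

Definition emit (R : nat) : prog :=
  Seq (Sto R cell (Mem cell
        + rv %% pow2 (rB - rpos %% rB) * pow2 (rpos %% rB))%E)
  (Seq (Sto R (cell + Lit 1)%E (rv %/ pow2 (rB - rpos %% rB))%E)
       (Asg R rpos (rpos + ru)%E)).

(* The factor [(32 ^ l - 1) / 31 * 3] is the string 11000 repeated [l] times. *)
Definition encode_word (R : nat) : prog :=
  While (R + rlen)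
    (Seq (Asg R rl (min_expr rh rlen))
    (Seq (Asg R rv (Lit 8 * Mem (rtab + rword %% pow2 rl)
                    + (pow2 (Lit 5 * rl) - Lit 1) %/ Lit 31 * Lit 3)%E)
    (Seq (Asg R ru (Lit 5 * rl)%E)
    (Seq (emit R)
    (Seq (Asg R rword (rword %/ pow2 rl)%E)
         (Asg R rlen (rlen - rl)%E)))))).

(** The last emission, the value 3 in 2 bits, is the closing 11 of [wrap]. *)
Definition encode (R : nat) : prog :=
  Seq (While (R + rrem)
    (Seq (Asg R rword (Mem rsrc))
    (Seq (Asg R rsrc (rsrc + Lit 1)%E)
    (Seq (Asg R rlen (min_expr rb rrem))
    (Seq (Asg R rrem (rrem - rlen)%E)
         (encode_word R))))))
  (Seq (Asg R rv (Lit 3)) (Seq (Asg R ru (Lit 2)) (emit R))).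

Ltac safety :=
  repeat (match goal with
    | |- _ /\ _ => split
    | |- [/\ _, _ & _] => split
    | |- True => exact I end).

(* [lia] diverges on powers and on divisions by variables, which are atoms here. *)
Ltac genlia :=
  repeat match goal with
    | H : is_true _ |- _ => revert H
    | H : @eq nat _ _ |- _ => revert H end;
  repeat match goal with
    | |- context [expn ?a ?b] => let x := fresh in generalize (expn a b); intro x end;
  repeat match goal with
    | |- context [modn ?a ?b] => let x := fresh in generalize (modn a b); intro x
    | |- context [divn ?a ?b] => let x := fresh in generalize (divn a b); intro x end;
  intros; lia.

Lemma minE x y : (y < x) * y + (1 - (y < x)) * x = minn x y.
Proof. by case: (ltnP y x) => h /=; lia. Qed.

Lemma eval_min rho mm e1 e2 :
  eval rho mm (min_expr e1 e2) = minn (eval rho mm e1) (eval rho mm e2).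
Proof. exact: minE. Qed.

Lemma safe_min W M rho mm e1 e2 : 1 < W ->
  safe W M rho mm e1 -> safe W M rho mm e2 ->
  eval rho mm e1 < W -> eval rho mm e2 < W ->
  safe W M rho mm (min_expr e1 e2).
Proof.
move=> W1 s1 s2 l1 l2; rewrite /=.
by case: (ltnP (eval rho mm e2) (eval rho mm e1)) => lt; safety => //=;
  rewrite ?mul1n ?mul0n ?add0n ?addn0 //; lia.
Qed.

Section Encode.

Variables (w M R : nat).
Variables (n m k b B h tab X out y thr cnt : nat).
Local Notation W := (2 ^ w).
Local Notation st p src rem x len l v u :=
  [:: n; m; k; b; B; h; tab; X; out; p; src; rem; x; len; l; v; u; y; thr; cnt].
Local Notation digit U j := (U %/ 2 ^ (B * j) %% 2 ^ B).
Local Notation wp := (wp w M R).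

Hypotheses (w_gt0 : 0 < w) (MW : M <= W) (W_big : 256 <= W) (B_gt0 : 0 < B) (BW : B < w).

Let exp_lt e : e <= B -> 2 ^ e < W.
Proof. by move=> eB; rewrite ltn_exp2l //; lia. Qed.

Let B_lt : B < W.
Proof. by apply: leq_trans (_ : w < W); [lia | exact: ltn_expl]. Qed.

Lemma wp_emit mm c V p src rem x len l v u :
  (forall j, mm (out + j) = digit V j) -> V < 2 ^ p -> u <= B -> v < 2 ^ u ->
  out + p %/ B + 1 < M -> p + u < W ->
  wp (emit R) c (st p src rem x len l v u) mm (fun c' rho' m' =>
   [/\ c' = c + 69, rho' = st (p + u) src rem x len l v u,
       forall a, a < out -> m' a = mm a
     & forall j, m' (out + j) = digit (V + v * 2 ^ p) j]).
Proof.
move=> mV Vp uB vu outM puW.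
have rB := ltn_pmod p B_gt0.
have vW : v < W by apply: leq_trans vu _; apply: ltnW; apply: exp_lt.
have E0 := digit_emit0 v B_gt0 Vp; have E1 := digit_emit1 B_gt0 Vp uB vu.
have dV : mm (out + p %/ B) < W.
  by rewrite mV; apply: leq_trans (_ : 2 ^ B <= W);
    [rewrite ltn_mod expn_gt0 | apply: ltnW; apply: exp_lt].
(* No overflow: by [E0] the sum is itself a base 2^B digit. *)
have sum : mm (out + p %/ B) + v %% 2 ^ (B - p %% B) * 2 ^ (p %% B) < W.
  rewrite mV -E0; apply: leq_trans (_ : 2 ^ B <= W);
    [by rewrite ltn_mod expn_gt0 | by apply: ltnW; apply: exp_lt].
have e1 := @exp_lt (B - p %% B) (leq_subr _ _).
have e2 := @exp_lt (p %% B) (ltnW rB).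
apply: wp_seq; apply: wp_sto => //; rewrite /= ?mul1n.
- by safety; genlia.
- safety; try genlia.
- by genlia.
apply: wp_seq; apply: wp_sto => //; rewrite /= ?mul1n.
- by safety; genlia.
- by safety; genlia.
apply: wp_asg => //; rewrite /=; first by safety; genlia.
split=> //; first by genlia.
- by move=> a aout; rewrite /upd !ifN //; apply/eqP; genlia.
- move=> j; rewrite /upd -addnA addn1 !eqn_add2l.
  case: (eqVneq j (p %/ B).+1) => [->|j1]; first by rewrite E1.
  case: (eqVneq j (p %/ B)) => [->|j0].
    by rewrite mV E0.
  by rewrite mV (digit_emit B_gt0 Vp uB vu).
Qed.

Variable base : nat -> nat.

Hypotheses (h_gt0 : 0 < h) (hB : 5 * h <= B) (Bh : B < 10 * h)
  (bB : b <= B) (b_gt0 : 0 < b) (tab_out : tab + 2 ^ h <= out)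
  (table : forall z, z < 2 ^ h -> base (tab + z) = spread h z).

(* The bits of [sigma] have been written from the cell [out] on, the cells
   below are those of [base]. *)
Definition written (mm : nat -> nat) (sigma : seq bool) : Prop :=
  (forall a, a < out -> mm a = base a) /\
  (forall j, mm (out + j) = digit (bits_to_nat sigma) j).

Lemma wp_emit_bits mm c sigma tau src rem x len l v u :
  written mm sigma -> v = bits_to_nat tau -> u = size tau -> u <= B ->
  out + (size sigma + u) %/ B + 1 < M -> size sigma + u < W ->
  wp (emit R) c (st (size sigma) src rem x len l v u) mm (fun c' rho' m' =>
   [/\ c' = c + 69, rho' = st (size (sigma ++ tau)) src rem x len l v u
     & written m' (sigma ++ tau)]).
Proof.
move=> [m1 m2] vE uE uB outM sW.
have vu : v < 2 ^ u by rewrite vE uE bits_lt.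
have le : size sigma %/ B <= (size sigma + u) %/ B by apply: leq_div2r; lia.
apply: wp_mono.
  apply: (@wp_emit mm c (bits_to_nat sigma)) => //; first exact: bits_lt.
  by genlia.
move=> c' rho' m' [-> -> f1 f2]; split=> //; first by rewrite size_cat -uE.
split=> [a aout|j]; first by rewrite f1 // m1.
by rewrite f2 bits_cat vE.
Qed.

Lemma wp_encode_word c0 mm s sigma src rem l v u :
  written mm sigma -> size s <= b ->
  out + (size sigma + 5 * size s) %/ B + 1 < M -> size sigma + 5 * size s < W ->
  wp (encode_word R) c0 (st (size sigma) src rem (bits_to_nat s) (size s) l v u) mm
   (fun c' rho' m' => [/\ c' <= c0 + 2000, written m' (sigma ++ phi s)
     & exists x' l' v' u', rho' = st (size (sigma ++ phi s)) src rem x' 0 l' v' u']).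
Proof.
move=> wr sb outM sW.
(* Ten rounds suffice because b <= B < 10 h, and a round costs at most 190 steps; this makes the
   cost per input word constant. *)
pose I j c rho mm := exists done todo l v u,
  [/\ s = done ++ todo, size todo <= j * h, c + 190 * j <= c0 + 190 * 10,
     written mm (sigma ++ phi done)
   & rho = st (size (sigma ++ phi done)) src rem (bits_to_nat todo) (size todo) l v u].
apply: wp_mono.
  apply: (@wp_while w M R w_gt0 13 _ I 10).
  - by move=> j c rho m1 [? [? [? [? [? [_ _ _ _ ->]]]]]].
  - move=> j c rho m1 [done [todo [l1 [v1 [u1 [sE tj cj wr1 ->]]]]]] /= todoN0.
    have j_gt0 : 0 < j by rewrite lt0n; apply/eqP=> j0; rewrite j0 in tj; lia.
    exists j.-1; first by lia.
    set lc := minn h (size todo).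
    have lch : lc <= h by apply: geq_minl.
    have lct : lc <= size todo by apply: geq_minr.
    have lc0 : 0 < lc by rewrite leq_min h_gt0 lt0n.
    have lcE : lc = minn h (size todo) by [].
    clearbody lc.
    have hs : 2 ^ h < W by apply: exp_lt; lia.
    have ls : size todo <= size s by rewrite sE size_cat leq_addl.
    have xlt := bits_lt todo.
    have xW : bits_to_nat todo < W.
      by apply: leq_trans xlt _; apply: ltnW; apply: exp_lt; genlia.
    have ps : size (sigma ++ phi done) + 5 * lc <= size sigma + 5 * size s.
      by rewrite sE !size_cat size_phi; genlia.
    have hW : h < W by genlia.
    have sW1 : size todo < W by genlia.
    apply: wp_seq; apply: wp_asg => //; first by apply: safe_min => //=; genlia.
    rewrite eval_min /= -lcE.
    have lcW := exp_lt (e := lc) ltac:(genlia).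
    have lcW5 := exp_lt (e := 5 * lc) ltac:(genlia).
    have lh2 : 2 ^ lc <= 2 ^ h by rewrite leq_exp2l.
    have ylt : bits_to_nat todo %% 2 ^ lc < 2 ^ lc by rewrite ltn_mod expn_gt0.
    have ys : bits_to_nat todo %% 2 ^ lc = bits_to_nat (take lc todo) by rewrite bits_take.
    have tabE : m1 (tab + bits_to_nat todo %% 2 ^ lc) =
        spread h (bits_to_nat todo %% 2 ^ lc).
      by case: wr1 => f _; rewrite f ?table //; genlia.
    have st : size (take lc todo) = lc by rewrite size_takel.
    have vE := @bits_phi h (take lc todo) ltac:(by rewrite st).
    rewrite st -ys -tabE in vE.
    have vlt := bits_lt (phi (take lc todo)); rewrite -vE size_phi st in vlt.
    have pow_gt0 : 0 < 2 ^ (5 * lc) by rewrite expn_gt0.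
    have le_div : (size (sigma ++ phi done) + 5 * lc) %/ B
        <= (size sigma + 5 * size s) %/ B by rewrite leq_div2r.
    apply: wp_seq; apply: wp_asg => //; rewrite /= ?mul1n.
      by safety; genlia.
    apply: wp_seq; apply: wp_asg => //; rewrite /=.
      by safety; genlia.
    apply: wp_seq; apply: wp_mono.
      apply: (@wp_emit_bits m1 _ _ (phi (take lc todo))) => //.
      - by rewrite size_phi st.
      - by genlia.
      - by genlia.
      - by genlia.
    move=> c1 rho1 m2 [-> -> wr2].
    apply: wp_seq; apply: wp_asg => //; rewrite /= ?mul1n; first by safety; genlia.
    apply: wp_asg => //; rewrite /=; first by safety; genlia.
    exists (done ++ take lc todo), (drop lc todo).
    exists lc, (bits_to_nat (phi (take lc todo))), (5 * lc).
    rewrite phi_cat catA; split=> //.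
    + by rewrite -catA cat_take_drop.
    + rewrite size_drop lcE; move: tj; rewrite -(prednK j_gt0) mulSn.
      by rewrite /minn; case: ifP; genlia.
    + by genlia.
    + by rewrite bits_drop size_drop vE.
  - exists [::], s, l, v, u; rewrite [phi [::]]/= cats0; split=> //; genlia.
move=> c1 rho1 m1 [todo0 [j [c2 [-> [done [todo [l1 [v1 [u1 [sE tj cj wr1 E]]]]]]]]]].
rewrite E in todo0 *; have t0 : todo = [::] by apply: size0nil.
rewrite t0 cats0 in sE; rewrite sE; split=> //; first by genlia.
by exists (bits_to_nat todo), l1, v1, u1; rewrite t0.
Qed.

Lemma wp_encode c0 mm s sigma src x len l v u :
  written mm sigma ->
  (forall i, i < size (pack b s) -> base (src + i) = nth 0 (pack b s) i) ->
  src + size (pack b s) <= tab ->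
  out + (size sigma + (5 * size s + 2)) %/ B + 1 < M ->
  size sigma + (5 * size s + 2) < W ->
  wp (encode R) c0 (st (size sigma) src (size s) x len l v u) mm
   (fun c' rho' m' => [/\ c' <= c0 + 3000 * (size (pack b s)).+1,
       written m' (sigma ++ wrap s)
     & exists x' len' l' v' u', rho' =
         st (size (sigma ++ wrap s)) (src + size (pack b s)) 0 x' len' l' v' u']).
Proof.
move=> wr ms stab outM sW.
(* Each unread word carries a budget of 2100 steps: 2000 for [wp_encode_word], the rest for fetching
   it. The source can be read from [base] because emission changes no cell below [out]. *)
pose I j c rho mm := exists done todo src' x len l v u,
  [/\ s = done ++ todo, size todo <= j,
     c + 2100 * size (pack b todo) <= c0 + 2100 * size (pack b s),
     written mm (sigma ++ phi done) &
   [/\ src' + size (pack b todo) = src + size (pack b s),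
       (forall i, i < size (pack b todo) -> base (src' + i) = nth 0 (pack b todo) i)
     & rho = st (size (sigma ++ phi done)) src' (size todo) x len l v u]].
have W1 : 1 < W by genlia.
have bW : b < W by genlia.
apply: wp_seq; apply: wp_mono.
  apply: (@wp_while w M R w_gt0 11 _ I (size s)).
  - move=> j c rho m1.
    by move=> [? [? [? [? [? [? [? [? [_ _ _ _ [_ _ ->]]]]]]]]]].
  - move=> j c rho m1.
    move=> [done [todo [src1 [x1 [len1 [l1 [v1 [u1]]]]]]]].
    move=> [sE tj cj wr1 [srcE ms1 ->]] /= todoN0.
    have todo_gt0 : 0 < size todo by rewrite lt0n.
    have pE := pack_cons b_gt0 todo_gt0.
    have spE : size (pack b todo) = (size (pack b (drop b todo))).+1 by rewrite pE.
    exists (size (drop b todo)); first by rewrite size_drop; genlia.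
    have word : m1 src1 = bits_to_nat (take b todo).
      have := ms1 0 ltac:(by rewrite spE); rewrite addn0 pE /= => <-.
      by case: wr1 => f _; apply: f; genlia.
    have st : size (take b todo) = minn b (size todo) by rewrite size_take_min.
    have word_lt := bits_lt (take b todo).
    have word_lt' : 2 ^ size (take b todo) < W.
      by apply: exp_lt; rewrite st; apply: leq_trans (geq_minl _ _) bB.
    have ls : size done + size todo = size s by rewrite sE size_cat.
    have lt : size (take b todo) <= size todo by rewrite st geq_minr.
    have lb : size (take b todo) <= b by rewrite st geq_minl.
    have ld : size (drop b todo) = size todo - size (take b todo).
      by rewrite size_drop st /minn; case: ifP; genlia.
    apply: wp_seq; apply: wp_asg => //; rewrite /= ?word.
      by safety; rewrite ?word; genlia.
    apply: wp_seq; apply: wp_asg => //; rewrite /=; first by safety; genlia.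
    apply: wp_seq; apply: wp_asg => //; first by apply: safe_min => //=; genlia.
    rewrite eval_min /= -st.
    apply: wp_seq; apply: wp_asg => //; rewrite /=; first by safety; genlia.
    have size_le : size (sigma ++ phi done) + 5 * size (take b todo)
        <= size sigma + (5 * size s + 2) by rewrite size_cat size_phi; genlia.
    have le_div := leq_div2r B size_le.
    apply: wp_mono.
      apply: wp_encode_word => //; genlia.
    move=> c1 rho1 m2 [c1E wr2 [x2 [l2 [v2 [u2 ->]]]]].
    exists (done ++ take b todo), (drop b todo), (src1 + 1), x2, 0, l2, v2, u2.
    rewrite phi_cat catA; split.
    + by rewrite -catA cat_take_drop.
    + by [].
    + by rewrite spE in cj; genlia.
    + by [].
    split; [by rewrite spE in srcE; genlia| |by rewrite ld].
    move=> i ilt; rewrite (_ : src1 + 1 + i = src1 + i.+1); last by rewrite addn1 addSnnS.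
    by rewrite ms1 ?spE // pE.
  - exists [::], s, src, x, len, l, v, u; rewrite [phi [::]]/= cats0.
    by split=> //; genlia.
move=> c1 rho1 m1 [t0 [j [c2 [-> ]]]].
move=> [done [todo [src1 [x1 [len1 [l1 [v1 [u1 [sE tj cj wr1 [srcE _ E]]]]]]]]]].
rewrite E in t0 *; have todo0 : todo = [::] by apply: size0nil.
rewrite todo0 cats0 in sE; rewrite -{}sE in wr1 *.
have p0 : size (pack b [::]) = 0 by rewrite size_pack divn_small //=; lia.
rewrite todo0 p0 addn0 in srcE; rewrite srcE todo0.
apply: wp_seq; apply: wp_asg => //; rewrite /=; first by genlia.
apply: wp_seq; apply: wp_asg => //; rewrite /=; first by genlia.
apply: wp_mono.
  apply: (@wp_emit_bits m1 _ _ [:: true; true]) => //.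
  - by genlia.
  - by move: outM; rewrite size_cat size_phi addnA.
  - by move: sW; rewrite size_cat size_phi addnA.
move=> c3 rho3 m3 [-> -> wr3]; rewrite /wrap catA; split=> //.
  by rewrite todo0 p0 in cj; genlia.
by exists x1, len1, l1, 3, 2.
Qed.

End Encode.

(** * The auxiliary loops: bit counting, table, patterns, copying and clearing *)

Definition ceil_expr (e d : expr) : expr := ((e + (d - Lit 1)) %/ d)%E.

(** The constant 16 is the closing 11 together with the 14 padding zeros. *)
Definition len1 : expr := (Lit 5 * rn + Lit 16)%E.
Definition len2 : expr := (rk * (Lit 5 * rm + Lit 2))%E.

Definition count_bits (R d : nat) : prog :=
  While (R + ry) (Seq (Asg R d (Var d + Lit 1)%E) (Asg R ry (ry %/ Lit 2)%E)).

Definition step_counters (R : nat) : prog :=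
  Seq (Asg R ry (ry + Lit 1)%E) (Asg R rcnt (rcnt - Lit 1)%E).

Definition fill_table (R : nat) : prog :=
  While (R + rcnt)
    (Seq (Sto R (rtab + ry)%E (ry %% Lit 2 + Lit 32 * Mem (rtab + ry %/ Lit 2))%E)
         (step_counters R)).

Definition encode_patterns (R : nat) : prog :=
  While (R + rcnt)
    (Seq (Asg R rrem rm) (Seq (encode R) (Asg R rcnt (rcnt - Lit 1)%E))).

Definition copy_down (R : nat) : prog :=
  While (R + rcnt) (Seq (Sto R ry (Mem (rX + ry)%E)) (step_counters R)).

Definition clear (R : nat) : prog :=
  While (R + rcnt) (Seq (Sto R ry (Lit 0)) (step_counters R)).

Section Loops.

Variables (w M R : nat).
Local Notation W := (2 ^ w).
Local Notation wp := (wp w M R).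
Hypotheses (w_gt0 : 0 < w) (MW : M <= W) (W_big : 256 <= W).
Variables (x0 x1 x2 x3 x4 x5 x6 x7 x8 x9 x10 x11 x12 x13 x14 x15 x16 x18 : nat).
Local Notation full y cnt := [:: x0; x1; x2; x3; x4; x5; x6; x7; x8; x9; x10;
  x11; x12; x13; x14; x15; x16; y; x18; cnt].

Lemma wp_count_bits c0 d y cnt mm :
  (d == 3) || (d == 4) -> y < W ->
  wp (count_bits R d) c0 (set_nth 0 (full y cnt) d 0) mm (fun c' rho' m' =>
    [/\ c' <= c0 + 20 * nbits y + 1, m' = mm
      & rho' = set_nth 0 (full 0 cnt) d (nbits y)]).
Proof.
move=> dE yW.
have bits_W z : z < W -> nbits z < W.
  move=> zW; rewrite /nbits; case: eqP => // z0; first by genlia.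
  apply: leq_ltn_trans (_ : w < W); last exact: ltn_expl.
  by apply: leq_lg.
pose I j c rho mm' := exists y' i,
  [/\ i + nbits y' = nbits y, y' <= j, y' <= y, c + 20 * nbits y' <= c0 + 20 * nbits y
    & mm' = mm /\ rho = set_nth 0 (full y' cnt) d i].
apply: wp_mono.
  apply: (@wp_while w M R w_gt0 17 _ I y).
  - move=> j c rho m1 [? [? [_ _ _ _ [_ ->]]]].
    by case/orP: dE => /eqP->.
  - move=> j c rho m1 [y' [i [iE yj yy cE [-> ->]]]] /=.
    have -> : nth 0 (set_nth 0 (full y' cnt) d i) 17 = y'.
      by case/orP: dE => /eqP->.
    rewrite -lt0n => y0; have nE := nbits_half y0.
    have bW := bits_W _ yW.
    exists (y' %/ 2); first by lia.
    have y2 : y' %/ 2 <= y' by exact: leq_div.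
    case/orP: dE => /eqP dd; rewrite dd; apply: wp_seq; apply: wp_asg => //=;
      (try by safety; genlia); apply: wp_asg => //=; (try by safety; genlia);
      exists (y' %/ 2), (i + 1); rewrite dd; split=> //; genlia.
  - by exists y, 0; split.
move=> c1 rho1 m1 [t0 [j [c2 [-> [y' [i [iE _ _ cE [-> rE]]]]]]]].
have y0 : y' = 0 by move: t0; rewrite rE; case/orP: dE => /eqP->.
rewrite y0 /nbits eqxx addn0 in iE cE; rewrite rE y0 iE; split=> //.
rewrite /nbits; genlia.
Qed.

Lemma wp_fill_table c0 mm :
  x5 < w -> x6 + 2 ^ x5 < M -> 5 * x5 < w ->
  (forall z, mm (x6 + z) = 0) ->
  wp (fill_table R) c0 (full 0 (2 ^ x5)) mm (fun c' rho' m' =>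
    [/\ c' <= c0 + 60 * 2 ^ x5 + 1, rho' = full (2 ^ x5) 0,
        forall a, a < x6 -> m' a = mm a,
        forall z, z < 2 ^ x5 -> m' (x6 + z) = spread x5 z
      & forall z, 2 ^ x5 <= z -> m' (x6 + z) = 0]).
Proof.
move=> x5w x6M x55w mm0.
have hW : 2 ^ x5 < W by rewrite ltn_exp2l.
have h5W : 2 ^ (5 * x5) < W by rewrite ltn_exp2l.
pose I j c rho mm' := exists y,
  [/\ y + j = 2 ^ x5, c + 60 * j <= c0 + 60 * 2 ^ x5, rho = full y j
    & forall a, mm' a = if (x6 <= a) && (a < x6 + y) then spread x5 (a - x6) else mm a].
apply: wp_mono.
  apply: (@wp_while w M R w_gt0 19 _ I (2 ^ x5)).
  - by move=> j c rho m1 [? [_ _ -> _]].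
  - move=> j c rho m1 [y [yE cE -> mE]] /= jN0.
    exists j.-1; first by lia.
    have y2 : y %/ 2 <= y by exact: leq_div.
    have y3 : y %% 2 < 2 by exact: ltn_pmod.
    have rd : m1 (x6 + y %/ 2) = spread x5 (y %/ 2).
      rewrite mE leq_addr ltn_add2l addKn /=.
      (* Only for y = 0 is the entry read not yet written; untouched memory then supplies the
         correct value 0. *)
      case: ltnP => // yy; have -> : y %/ 2 = 0 by lia.
      by rewrite spread0 mm0.
    have sE : y %% 2 + 32 * spread x5 (y %/ 2) = spread x5 y.
      by rewrite -spread_rec //; genlia.
    have sW : spread x5 y < W.
      by move: (spread_lt x5 y); rewrite mulnC ltn_pmul2r //; genlia.
    apply: wp_seq; apply: wp_sto => //; rewrite /= ?rd.
    + by safety; genlia.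
    + by safety; rewrite ?rd; genlia.
    + by genlia.
    apply: wp_seq; apply: wp_asg => //; rewrite /=; first by safety; genlia.
    apply: wp_asg => //; rewrite /=; first by safety; genlia.
    exists (y + 1); split.
    + by genlia.
    + by genlia.
    + by rewrite subn1.
    move=> a; rewrite /upd sE mE; case: eqP => [->|ne].
      by rewrite leq_addr ltn_add2l addn1 leqnn addKn.
    by rewrite addnA addn1 ltnS (leq_eqVlt a); case: eqP.
  - exists 0; split=> // a; rewrite addn0; case: ltnP => //; case: leqP => //; lia.
move=> c1 rho1 m1 [t0 [j [c2 [-> [y [yE cE rE mE]]]]]].
rewrite rE /= in t0 *; rewrite t0 addn0 in yE cE *.
split.
- by genlia.
- by rewrite yE.
- by move=> a a6; rewrite mE leqNgt a6.
- by move=> z z2; rewrite mE leq_addr ltn_add2l yE z2 addKn.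
- by move=> z z2; rewrite mE leq_addr ltn_add2l yE ltnNge z2 mm0.
Qed.

Lemma wp_copy_down c0 len mm :
  x7 + len < M -> (forall a, mm (x7 + a) < W) ->
  wp (copy_down R) c0 (full 0 len) mm (fun c' rho' m' =>
    [/\ c' <= c0 + 40 * len + 1, rho' = full len 0
      & forall a, m' a = if a < len then mm (x7 + a) else mm a]).
Proof.
move=> lM mmW.
pose I j c rho mm' := exists y,
  [/\ y + j = len, c + 40 * j <= c0 + 40 * len, rho = full y j
    & forall a, mm' a = if a < y then mm (x7 + a) else mm a].
apply: wp_mono.
  apply: (@wp_while w M R w_gt0 19 _ I len).
  - by move=> j c rho m1 [? [_ _ -> _]].
  - move=> j c rho m1 [y [yE cE -> mE]] /= jN0.
    exists j.-1; first by lia.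
    (* Copying in increasing order is safe even if the areas overlap: the cells overwritten so far
       lie below the one being read. *)
    have rd : m1 (x7 + y) = mm (x7 + y) by rewrite mE ltnNge leq_addl.
    have rdW := mmW y.
    apply: wp_seq; apply: wp_sto => //; rewrite /= ?rd.
    + by safety; genlia.
    + by safety; rewrite ?rd; genlia.
    + by genlia.
    apply: wp_seq; apply: wp_asg => //; rewrite /=; first by safety; genlia.
    apply: wp_asg => //; rewrite /=; first by safety; genlia.
    exists (y + 1); split.
    + by genlia.
    + by genlia.
    + by rewrite subn1.
    move=> a; rewrite /upd mE; case: eqP => [->|ne]; first by rewrite addn1 leqnn.
    by rewrite addn1 ltnS (leq_eqVlt a); case: eqP.
  - by exists 0; split.
move=> c1 rho1 m1 [t0 [j [c2 [-> [y [yE cE rE mE]]]]]].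
rewrite rE /= in t0 *; rewrite t0 addn0 in yE cE *.
split; first by genlia.
  by rewrite yE.
by rewrite -yE.
Qed.

Lemma wp_clear c0 y0 len mm :
  y0 + len < M ->
  wp (clear R) c0 (full y0 len) mm (fun c' rho' m' =>
    [/\ c' <= c0 + 40 * len + 1, rho' = full (y0 + len) 0
      & forall a, m' a = if (y0 <= a) && (a < y0 + len) then 0 else mm a]).
Proof.
move=> lM.
pose I j c rho mm' := exists y,
  [/\ y0 + y + j = y0 + len, c + 40 * j <= c0 + 40 * len, rho = full (y0 + y) j
    & forall a, mm' a = if (y0 <= a) && (a < y0 + y) then 0 else mm a].
have [->|len0] := posnP len.
  move=> r hr; exists 1, [::], r, (full y0 0), mm; split=> //.
    by apply: ExecWhileF; rewrite /= hr.
  rewrite addn0; split=> [||a] //; first by lia.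
  by case: ltnP => //; case: leqP => //; lia.
apply: wp_mono.
  apply: (@wp_while w M R w_gt0 19 _ I len).
  - by move=> j c rho m1 [? [_ _ -> _]].
  - move=> j c rho m1 [y [yE cE -> mE]] /= jN0.
    exists j.-1; first by lia.
    apply: wp_seq; apply: wp_sto => //; rewrite /=.
    + by safety; genlia.
    + by genlia.
    + by genlia.
    apply: wp_seq; apply: wp_asg => //; rewrite /=; first by safety; genlia.
    apply: wp_asg => //; rewrite /=; first by safety; genlia.
    exists (y + 1); split.
    + by genlia.
    + by genlia.
    + by rewrite subn1 addnA.
    move=> a; rewrite /upd mE; case: eqP => [->|ne].
      by rewrite leq_addr ltn_add2l addn1 leqnn.
    by rewrite addnA addn1 ltnS (leq_eqVlt a); case: eqP.
  - exists 0; rewrite addn0; split=> // a.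
    by case: ltnP => //; case: leqP => //; lia.
move=> c1 rho1 m1 [t0 [j [c2 [-> [y [yE cE rE mE]]]]]].
rewrite rE /= in t0 *; rewrite t0 addn0 in yE cE *.
split; first by genlia.
  by rewrite yE.
by rewrite -yE.
Qed.

End Loops.

Section Patterns.

Variables (w M R : nat).
Variables (n m k b B h tab X out y thr : nat) (base : nat -> nat).
Local Notation W := (2 ^ w).
Local Notation st p src rem x len l v u cnt :=
  [:: n; m; k; b; B; h; tab; X; out; p; src; rem; x; len; l; v; u; y; thr; cnt].
Local Notation wp := (wp w M R).
Local Notation packs D := (flatten [seq pack b P | P <- D]).
Local Notation wraps D := (flatten [seq wrap P | P <- D]).

Hypotheses (w_gt0 : 0 < w) (MW : M <= W) (W_big : 256 <= W) (B_gt0 : 0 < B)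
  (BW : B < w) (h_gt0 : 0 < h) (hB : 5 * h <= B) (Bh : B < 10 * h)
  (bB : b <= B) (b_gt0 : 0 < b) (tab_out : tab + 2 ^ h <= out)
  (table : forall z, z < 2 ^ h -> base (tab + z) = spread h z) (mW : m < W).

Lemma wp_encode_patterns c0 mm D src p rem x len l v u :
  p = 0 -> all (fun P => size P == m) D -> written B out base mm [::] ->
  (forall i, i < size (packs D) -> base (src + i) = nth 0 (packs D) i) ->
  src + size (packs D) <= tab ->
  out + (size D * (5 * m + 2)) %/ B + 1 < M -> size D * (5 * m + 2) < W ->
  size D < W ->
  wp (encode_patterns R) c0 (st p src rem x len l v u (size D)) mm
   (fun c' rho' m' => [/\ c' <= c0 + 3100 * (size (packs D) + size D) + 1,
       written B out base m' (wraps D)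
     & exists p' src' rem' x' len' l' v' u', rho' = st p' src' rem' x' len' l' v' u' 0]).
Proof.
move=> -> sD wr ms stab outM sW DW.
(* The budget counts patterns as well as words, since each pattern costs a constant for its closing
   marker and the loop control. *)
pose I j c rho mm := exists done todo src' rem x len l v u,
  [/\ D = done ++ todo, size todo <= j,
     c + 3100 * (size (packs todo) + size todo) <= c0 + 3100 * (size (packs D) + size D),
     written B out base mm (wraps done) &
   [/\ src' + size (packs todo) = src + size (packs D),
       (forall i, i < size (packs todo) -> base (src' + i) = nth 0 (packs todo) i)
     & rho = st (size (wraps done)) src' rem x len l v u (size todo)]].
apply: wp_mono.
  apply: (@wp_while w M R w_gt0 19 _ I (size D)).
  - move=> j c rho m1.
    by move=> [? [? [? [? [? [? [? [? [? [_ _ _ _ [_ _ ->]]]]]]]]]]].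
  - move=> j c rho m1.
    move=> [done [[|P todo] [src1 [rem1 [x1 [len1 [l1 [v1 [u1]]]]]]]]].
      by move=> [_ _ _ _ [_ _ ->]].
    move=> [DE tj cj wr1 [srcE ms1 ->]] /= _.
    have sP : size P = m by apply/eqP; apply: (allP sD); rewrite DE mem_cat mem_head orbT.
    have sdone : size (wraps done) = size done * (5 * m + 2).
      by apply: size_flatten_wrap; move: sD; rewrite DE all_cat => /andP[].
    have sDE : size D = size done + (size todo).+1 by rewrite DE size_cat.
    have size_le : size (wraps done) + (5 * size P + 2) <= size D * (5 * m + 2).
      by rewrite sdone sP sDE mulnDl mulSn leq_add2l leq_addr.
    have le_div := leq_div2r B size_le.
    have szE : size (packs (P :: todo)) = size (pack b P) + size (packs todo).
      by rewrite /= size_cat.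
    rewrite szE [size (P :: todo)]/= in cj; rewrite szE in srcE.
    exists (size todo); first exact: tj.
    apply: wp_seq; apply: wp_asg => //; rewrite /=.
    apply: wp_seq; apply: wp_mono.
      rewrite -sP.
      apply: (@wp_encode w M R n (size P) k b B h tab X out y thr (size todo).+1
        w_gt0 MW W_big B_gt0 BW base) => //.
      - move=> i ilt; rewrite ms1 /=; last by rewrite size_cat ltn_addr.
        by rewrite nth_cat ilt.
      - by genlia.
      - by genlia.
      - by genlia.
    rewrite sP => c1 rho1 m2 [c1E wr2 [x2 [len2 [l2 [v2 [u2 ->]]]]]].
    apply: wp_asg => //; rewrite /=; first by safety; genlia.
    exists (rcons done P), todo, (src1 + size (pack b P)), 0, x2, len2, l2, v2, u2.
    have wE : wraps (rcons done P) = wraps done ++ wrap P.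
      by rewrite map_rcons flatten_rcons.
    rewrite wE; split.
    + by rewrite cat_rcons.
    + by [].
    + by genlia.
    + by [].
    split; [by genlia| |by rewrite subn1].
    move=> i ilt; rewrite -addnA ms1 /= ?size_cat ?ltn_add2l //.
    by rewrite nth_cat ltnNge leq_addr /= addKn.
  - exists [::], D, src, rem, x, len, l, v, u.
    by split=> //; genlia.
move=> c1 rho1 m1 [t0 [j [c2 [-> ]]]].
move=> [done [todo [src1 [rem1 [x1 [len1 [l1 [v1 [u1 [DE tj cj wr1 [srcE _ E]]]]]]]]]]].
rewrite E in t0 *; have todo0 : todo = [::] by apply: size0nil.
rewrite todo0 cats0 in DE; rewrite -{}DE in wr1 *.
split; [by genlia | by [] | ].
by exists (size (wraps D)), src1, rem1, x1, len1, l1, v1, u1; rewrite todo0.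
Qed.

End Patterns.

(** * Building the LCF instance *)

Lemma leq_ceil b x : 0 < b -> (x + b.-1) %/ b <= x.
Proof.
move=> b0; rewrite -ltnS ltn_divLR // mulSn.
have : x * 1 <= x * b by rewrite leq_mul2l b0 orbT.
by lia.
Qed.

Lemma ceil_mul b x : 0 < b -> x <= b * ((x + b.-1) %/ b).
Proof.
move=> b0; have := divn_eq (x + b.-1) b; have := ltn_pmod (x + b.-1) b0.
by rewrite mulnC; genlia.
Qed.

Lemma div_ceil b x : 0 < b -> x %/ b <= (x + b.-1) %/ b.
Proof. by move=> b0; apply: leq_div2r; apply: leq_addr. Qed.

Definition load_parameters (R : nat) : prog :=
  Seq (Asg R rn (Mem (Lit 0)))
  (Seq (Asg R rm (Mem (Lit 1)))
  (Seq (Asg R rk (Mem (Lit 2)))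
  (Seq (Asg R ry (rn + rk * rm)%E)
  (Seq (Asg R rb (Lit 0))
  (Seq (count_bits R rb)
  (Seq (Asg R ry (len1 + len2)%E)
  (Seq (Asg R rB (Lit 0))
  (Seq (count_bits R rB)
  (Seq (Asg R rh (rB %/ Lit 5)%E)
  (Seq (Asg R rtab (Lit 3 + (ceil_expr rn rb + rk * ceil_expr rm rb))%E)
  (Seq (Asg R ry (Lit 0))
  (Asg R rcnt (pow2 rh)%E)))))))))))).

(** The padding of the first string is never emitted: the memory behind the stream is still 0, and
    the second stream starts only after all words reserved for [len1] bits. *)
Definition write_strings (R : nat) : prog :=
  Seq (Asg R rX (rtab + pow2 rh)%E)
  (Seq (Sto R rX len1)
  (Seq (Sto R (rX + Lit 1)%E len2)
  (Seq (Asg R rout (rX + Lit 2)%E)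
  (Seq (Asg R rpos (Lit 0))
  (Seq (Asg R rsrc (Lit 3))
  (Seq (Asg R rrem rn)
  (Seq (encode R)
  (Seq (Asg R rout (rout + ceil_expr len1 rB)%E)
  (Seq (Asg R rpos (Lit 0))
  (Seq (Asg R rcnt rk)
  (encode_patterns R))))))))))).

(** [copy_down] leaves [ry] just behind the copied instance of some length len. Clearing X + 3 cells
    from there reaches past X + len, where the original copy ends, and so removes input, table and
    original together. *)
Definition relocate (R : nat) : prog :=
  Seq (Asg R rcnt (rout - rX + ceil_expr len2 rB)%E)
  (Seq (Asg R ry (Lit 0))
  (Seq (copy_down R)
  (Seq (Asg R rcnt (rX + Lit 3)%E)
  (Seq (clear R)
  (Asg R rthr (Lit 5 * rm + Lit 1)%E))))).

Definition build (R : nat) : prog :=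
  Seq (load_parameters R)
  (Seq (fill_table R) (Seq (write_strings R) (relocate R))).

Ltac asg_with w0 :=
  apply: (wp_asg w0);
  [by [] | by [] | by rewrite /=; safety; genlia | rewrite /= ?mul1n].

Section Build.

Variables (w R n m k : nat) (T : seq bool) (D : seq (seq bool)).
Variables (b N1 N2 B h tab X o1 o2 M : nat).
Local Notation W := (2 ^ w).
Local Notation wp := (wp w M R).
Local Notation cn := ((n + b.-1) %/ b).
Local Notation cm := ((m + b.-1) %/ b).
Local Notation packs D := (flatten [seq pack b P | P <- D]).
Local Notation wraps D := (flatten [seq wrap P | P <- D]).
Local Notation inp := [:: n, m, k & pack b T ++ packs D].
Local Notation S1 := (wrap T ++ nseq 14 false).
Local Notation S2 := (wraps D).

Hypotheses (n_gt0 : 0 < n) (m_gt0 : 0 < m) (k_gt0 : 0 < k).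
Hypotheses (sT : size T = n) (sD : all (fun P => size P == m) D) (kD : size D = k).
Hypotheses (bE : b = lg (n + k * m)) (N1E : N1 = 5 * n + 16) (N2E : N2 = k * (5 * m + 2)).
Hypotheses (BE : B = lg (N1 + N2)) (hE : h = B %/ 5).
Hypotheses (tabE : tab = 3 + (cn + k * cm)) (XE : X = tab + 2 ^ h).
Hypotheses (o1E : o1 = (N1 + B.-1) %/ B) (o2E : o2 = (N2 + B.-1) %/ B).
Hypotheses (ME : M = X + (2 + o1 + o2) + 4) (wb : b + 8 <= w).

Lemma b_gt0 : 0 < b. Proof. by rewrite bE. Qed.

Lemma B_gt0 : 0 < B. Proof. by rewrite BE. Qed.

Lemma k_le : k <= k * m. Proof. by rewrite leq_pmulr. Qed.

Lemma total_lt : n + k * m < 2 ^ b. Proof. by rewrite bE lt_lg. Qed.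

Lemma N_lt : N1 + N2 < 2 ^ B. Proof. by rewrite BE lt_lg. Qed.

(** The factor 21 is 5 + 16, with the padding constant absorbed by n >= 1; the pattern side needs
    only 5 + 2, since k <= k m. *)
Lemma N_le : N1 + N2 <= 21 * (n + k * m).
Proof.
clear -n_gt0 m_gt0 N1E N2E. by rewrite N1E N2E; move: k_le n_gt0; genlia. Qed.

Lemma b_le_B : b <= B.
Proof.
clear -bE BE N1E N2E.
rewrite bE; apply: leq_lg B_gt0 _; apply: leq_ltn_trans N_lt.
by rewrite N1E N2E; genlia.
Qed.

(** This holds because 21 < 2^5. *)
Lemma B_le : B <= b + 5.
Proof.
clear -n_gt0 m_gt0 bE BE N1E N2E.
rewrite BE; apply: leq_lg; first by rewrite addnS.
by rewrite expnD (_ : 2 ^ 5 = 32) //; move: N_le total_lt; genlia.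
Qed.

(** The padding serves this bound: N1 >= 21 even for n = 1, hence h = B / 5 is positive. *)
Lemma B_ge5 : 5 <= B.
Proof.
clear -n_gt0 BE N1E.
rewrite leqNgt; apply/negP => B4; have := N_lt.
have : 2 ^ B <= 16 by rewrite (_ : 16 = 2 ^ 4) // leq_exp2l.
by genlia.
Qed.

Lemma h_bounds : [/\ 0 < h, 5 * h <= B & B < 10 * h].
Proof.
clear -n_gt0 BE N1E hE.
have := divn_eq B 5; have := ltn_pmod B (isT : 0 < 5); move: B_ge5.
by rewrite -hE; split; genlia.
Qed.

Lemma size_packs : size (packs D) = k * cm.
Proof.
rewrite -kD; elim: D sD => //= P D' IH /andP[/eqP sP sD'].
by rewrite size_cat size_pack sP IH.
Qed.

Lemma size_inp : size inp = tab.
Proof. by rewrite /= size_cat size_pack sT size_packs tabE. Qed.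

Lemma size_S1 : size S1 = N1.
Proof. by rewrite size_cat size_wrap size_nseq sT N1E -addnA. Qed.

Lemma size_S2 : size S2 = N2.
Proof. by rewrite (size_flatten_wrap sD) kD N2E. Qed.

(** The table has at most 2^B <= 32 * 2^b entries, and the remaining parts of the memory take at
    most about 22 * 2^b cells, so eight spare bits leave room for every address. *)
Lemma word_bounds : [/\ 256 * 2 ^ b <= W, M <= W, 256 <= W & B < w].
Proof.
have W1 : 256 * 2 ^ b <= W.
  by rewrite mulnC (_ : 256 = 2 ^ 8) // -expnD leq_exp2l.
have b1 : 0 < 2 ^ b by rewrite expn_gt0.
have h1 : 2 ^ h <= 2 ^ B by rewrite leq_exp2l //; case: h_bounds; genlia.
have B1 : 2 ^ B <= 32 * 2 ^ b.
  by rewrite mulnC (_ : 32 = 2 ^ 5) // -expnD leq_exp2l // B_le.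
have c1 := leq_ceil n b_gt0; have c2 := leq_ceil m b_gt0.
have c3 : k * cm <= k * m by rewrite leq_mul2l c2 orbT.
have c4 := leq_ceil N1 B_gt0; have c5 := leq_ceil N2 B_gt0.
rewrite -o1E in c4; rewrite -o2E in c5.
have := total_lt; have := N_le; have := B_le.
move=> Bb Nl tl; split.
- exact: W1.
- rewrite ME XE tabE.
  move: c3 c1 c4 c5 tl Nl h1 B1 W1 b1; move: (2 ^ h) (2 ^ b) (2 ^ B) W => z1 z2 z3 z4.
  by move: cn (k * cm) (k * m) => z5 z6 z7; genlia.
- by move: W1 b1; move: (2 ^ b) W => z2 z4; genlia.
- by genlia.
Qed.

Local Notation st n m k b B h tab X out p src rem x len l v u y thr cnt :=
  [:: n; m; k; b; B; h; tab; X; out; p; src; rem; x; len; l; v; u; y; thr; cnt].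

Lemma wp_load_parameters :
  wp (load_parameters R) 0 (nseq 20 0) (nth 0 inp) (fun c' rho' m' =>
    [/\ c' <= 200 + 20 * b + 20 * B, m' = nth 0 inp
      & rho' = st n m k b B h tab 0 0 0 0 0 0 0 0 0 0 0 0 (2 ^ h)]).
Proof.
have [W1 MW W_big Bw] := word_bounds.
have b0 := b_gt0; have B0 := B_gt0; have [h0 hB Bh] := h_bounds.
have w0 : 0 < w by genlia.
have tl := total_lt; have kl := k_le; have Nl := N_le.
have c1 := leq_ceil n b_gt0; have c2 := leq_ceil m b_gt0.
have c3 : k * cm <= k * m by rewrite leq_mul2l c2 orbT.
have bB := b_le_B.
have bB' := B_le.
have wW : w < W by exact: ltn_expl.
have hW : 2 ^ h < W by rewrite ltn_exp2l //; genlia.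
have km : m <= k * m by rewrite leq_pmull.
have mM : 3 < M by genlia.
have bb : b < 2 ^ b by exact: ltn_expl.
rewrite /nseq /=.
apply: wp_seq; asg_with w0.
apply: wp_seq; asg_with w0.
apply: wp_seq; asg_with w0.
apply: wp_seq; asg_with w0.
apply: wp_seq; asg_with w0.
apply: wp_seq; apply: wp_mono.
  by apply: (@wp_count_bits w M R w0 MW W_big n m k 0 0 0 0 0 0 0 0 0 0 0 0 0 0 0
    _ 3 (n + k * m) 0) => //; genlia.
have -> : nbits (n + k * m) = b by rewrite /nbits bE gtn_eqF // addn_gt0 n_gt0.
move=> c1' rho1 m1 [cE -> ->] /=.
apply: wp_seq; asg_with w0.
rewrite -N1E -N2E.
apply: wp_seq; asg_with w0.
apply: wp_seq; apply: wp_mono.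
  by apply: (@wp_count_bits w M R w0 MW W_big n m k b 0 0 0 0 0 0 0 0 0 0 0 0 0 0
    _ 4 (N1 + N2) 0) => //; genlia.
have -> : nbits (N1 + N2) = B by rewrite /nbits BE gtn_eqF // N1E addnS.
move=> c2' rho2 m2 [cE2 -> ->] /=.
apply: wp_seq; asg_with w0.
rewrite -hE.
rewrite -!subn1 in c1 c3; apply: wp_seq.
asg_with w0.
rewrite !subn1 -tabE.
apply: wp_seq; asg_with w0.
asg_with w0.
by split=> //; genlia.
Qed.

Lemma lg_strings : lg (size S1 + size S2) = B.
Proof. by rewrite size_S1 size_S2 BE. Qed.

(** Trailing zeros do not change [bits_to_nat], so the words of the first string are digits of
    [wrap T] alone. *)
Lemma nth_LCF_input i : nth 0 (LCF_input S1 S2) i =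
  if i == 0 then N1 else if i == 1 then N2 else
  if i < 2 + o1 then bits_to_nat (wrap T) %/ 2 ^ (B * (i - 2)) %% 2 ^ B
  else bits_to_nat S2 %/ 2 ^ (B * (i - (2 + o1))) %% 2 ^ B.
Proof.
rewrite /LCF_input lg_strings size_S1 size_S2.
have := size_S1; have := bits_nseq 14; move: (nseq 14 false) => Z Z0 sZ.
case: i => [|[|i]] //=; rewrite nth_cat size_pack sZ -o1E !addSn add0n !ltnS.
have B0 := B_gt0.
case: ltnP => io; rewrite nth_pack //.
by rewrite bits_cat Z0 mul0n addn0 subn2.
Qed.

Lemma LCF_input_lt i : nth 0 (LCF_input S1 S2) i < W.
Proof.
have [W1 MW W_big Bw] := word_bounds.
have BW : 2 ^ B < W by rewrite ltn_exp2l.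
have Nl := N_lt.
rewrite nth_LCF_input; case: ifP => _; first by genlia.
case: ifP => _; first by genlia.
by case: ifP => _; apply: leq_trans (ltnW BW); rewrite ltn_mod expn_gt0.
Qed.

Lemma wp_write_strings c0 mm :
  (forall a, a < tab -> mm a = nth 0 inp a) ->
  (forall z, z < 2 ^ h -> mm (tab + z) = spread h z) ->
  (forall z, 2 ^ h <= z -> mm (tab + z) = 0) ->
  wp (write_strings R) c0 (st n m k b B h tab 0 0 0 0 0 0 0 0 0 0 (2 ^ h) 0 0) mm
   (fun c' rho' m' =>
    [/\ c' <= c0 + 3000 * cn + 3100 * (k * cm + k) + 3300,
       forall i, m' (X + i) = nth 0 (LCF_input S1 S2) i
     & exists p src rem x len l v u, rho' =
       st n m k b B h tab X (X + 2 + o1) p src rem x len l v u (2 ^ h) 0 0]).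
Proof.
move=> mm_inp mm_tab mm_0.
have [W1 MW W_big Bw] := word_bounds.
have b0 := b_gt0; have B0 := B_gt0; have [h0 hB Bh] := h_bounds.
have w0 : 0 < w by genlia.
have bb : b < 2 ^ b by exact: ltn_expl.
have tl := total_lt; have kl := k_le; have Nl := N_le.
have bB := b_le_B; have bB' := B_le.
have km : m <= k * m by rewrite leq_pmull.
have c1 := leq_ceil n b_gt0; have c2 := leq_ceil m b_gt0.
have c3 : k * cm <= k * m by rewrite leq_mul2l c2 orbT.
have wW : w < W by exact: ltn_expl.
have hW : 2 ^ h < W by rewrite ltn_exp2l //; genlia.
have N1W : N1 < W by genlia.
have N2W : N2 < W by genlia.
have d1 := div_ceil N1 B0; have d2 := div_ceil N2 B0.
rewrite -o1E in d1; rewrite -o2E in d2.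
have le1 : (5 * n + 2) %/ B <= N1 %/ B by apply: leq_div2r; genlia.
have km5 : k * (5 * m) <= N2 by rewrite N2E leq_mul2l leq_addr orbT.
have k2 : k * 2 <= N2 by rewrite N2E leq_mul2l leq_addl orbT.
have m5 : 5 * m + 2 <= N2 by rewrite N2E leq_pmull.
apply: wp_seq; asg_with w0; rewrite -XE.
apply: wp_seq; apply: (wp_sto w0); rewrite /= -?N1E //.
  by safety; genlia.
  by safety; genlia.
  by genlia.
apply: wp_seq; apply: (wp_sto w0); rewrite /= -?N2E //.
  by safety; genlia.
  by safety; genlia.
  by genlia.
apply: wp_seq; asg_with w0.
apply: wp_seq; asg_with w0.
apply: wp_seq; asg_with w0.
apply: wp_seq; asg_with w0.
set m2 := upd _ _ _.
have m2_inp a : a < tab -> m2 a = nth 0 inp a.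
  move=> at_; rewrite /m2 /upd !ifN ?mm_inp //; apply/eqP; genlia.
have m2_tab z : z < 2 ^ h -> m2 (tab + z) = spread h z.
  by move=> zh; rewrite /m2 /upd !ifN ?mm_tab //; apply/eqP; genlia.
have wr0 : written B (X + 2) m2 m2 [::].
  split=> // j; rewrite /= div0n mod0n /m2 /upd !ifN; try (apply/eqP; genlia).
  by rewrite XE -!addnA mm_0 // leq_addr.
apply: wp_seq; apply: wp_mono.
  have tX : tab + 2 ^ h <= X + 2 by rewrite XE leq_addr.
  have enc := @wp_encode w M R n m k b B h tab X (X + 2) (2 ^ h) 0 0
    w0 MW W_big B0 Bw m2 h0 hB Bh bB b0.
  have := enc tX m2_tab _ m2 T [::] 3 0 0 0 0 0 wr0.
  rewrite sT; apply.
  - move=> i iT; rewrite m2_inp; last by rewrite tabE -sT -size_pack; genlia.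
    by rewrite /= nth_cat iT.
  - by rewrite size_pack sT tabE; genlia.
  - by rewrite [size [::]]/= add0n; genlia.
  - by rewrite [size [::]]/= add0n; genlia.
move=> c4 rho4 m4 [c4E wr4 [x4 [len4 [l4 [v4 [u4 ->]]]]]].
rewrite [size ([::] ++ _)]/= size_wrap sT size_pack sT in c4E *.
rewrite cat0s in wr4; case: wr4 => m4_lo m4_hi.
have o1E' : o1 = (5 * n + 16 + (B - 1)) %/ B by rewrite o1E N1E subn1.
apply: wp_seq; asg_with w0; rewrite -o1E'.
apply: wp_seq; asg_with w0.
apply: wp_seq; asg_with w0.
have m4_inp a : a < tab -> m4 a = nth 0 inp a.
  by move=> at_; rewrite m4_lo ?m2_inp //; genlia.
(* The number written so far has fewer than B * o1 bits, so all its digits from [o1] on are 0 and a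
   fresh stream may start there. *)
have wr5 : written B (X + 2 + o1) m4 m4 [::].
  split=> // j; rewrite /= div0n mod0n -addnA m4_hi divn_small ?mod0n //.
  apply: leq_trans (bits_lt _) _; rewrite leq_exp2l // size_wrap sT.
  have := ceil_mul N1 B0; rewrite -o1E mulnDr; genlia.
apply: wp_mono.
  rewrite -{2}kD.
  apply: (@wp_encode_patterns w M R n m k b B h tab X (X + 2 + o1) (2 ^ h) 0 m4
    w0 MW W_big B0 Bw h0 hB Bh bB b0) => //.
  - by genlia.
  - by move=> z zh; rewrite m4_lo ?m2_tab //; genlia.
  - by genlia.
  - move=> i iD; rewrite m4_inp; last by rewrite size_packs in iD; genlia.
    rewrite -addnA (_ : nth 0 inp (3 + _) = nth 0 (pack b T ++ packs D) (cn + i)) //.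
    by rewrite nth_cat size_pack sT ltnNge leq_addr /= addKn.
  - by rewrite size_packs tabE addnA.
  - by rewrite kD -N2E; genlia.
  - by rewrite kD -N2E; genlia.
  - by rewrite kD; genlia.
move=> c6 rho6 m6 [c6E [m6_lo m6_hi] [p6 [s6 [r6 [x6 [len6 [l6 [v6 [u6 ->]]]]]]]]].
rewrite size_packs kD in c6E; split; first by genlia.
  move=> i; rewrite nth_LCF_input.
  case: eqP => [->|i0].
    rewrite addn0 m6_lo ?m4_lo; try genlia.
    by rewrite /m2 /upd eqxx ifN //; apply/eqP; genlia.
  case: eqP => [->|i1].
    rewrite m6_lo ?m4_lo; try genlia.
    by rewrite /m2 /upd eqxx.
  have i2 : 1 < i by case: (i) i0 i1 => [|[|i']].
  case: ltnP => io.
    rewrite m6_lo -?addnA ?ltn_add2l //.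
    by rewrite (_ : X + i = X + 2 + (i - 2)) ?m4_hi // -addnA subnKC.
  rewrite (_ : X + i = X + 2 + o1 + (i - (2 + o1))) ?m6_hi //.
  by rewrite -[X + 2 + o1]addnA -addnA subnKC.
by exists p6, s6, r6, x6, len6, l6, v6, u6.
Qed.

Lemma wp_relocate c0 mm p src rem x len l v u :
  (forall i, mm (X + i) = nth 0 (LCF_input S1 S2) i) ->
  wp (relocate R) c0 (st n m k b B h tab X (X + 2 + o1) p src rem x len l v u (2 ^ h) 0 0) mm
   (fun c' rho' m' =>
    [/\ c' <= c0 + 80 * M + 100, m' =1 nth 0 (LCF_input S1 S2),
       18 < size rho' & nth 0 rho' 18 = 5 * m + 1]).
Proof.
move=> mmX.
have [W1 MW W_big Bw] := word_bounds.
have B0 := B_gt0; have bB := b_le_B; have bB' := B_le.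
have w0 : 0 < w by genlia.
have tl := total_lt; have kl := k_le; have Nl := N_le.
have wW : w < W by exact: ltn_expl.
have km : m <= k * m by rewrite leq_pmull.
have bb : b < 2 ^ b by exact: ltn_expl.
have km5 : k * (5 * m) <= N2 by rewrite N2E leq_mul2l leq_addr orbT.
have k2 : k * 2 <= N2 by rewrite N2E leq_mul2l leq_addl orbT.
have m5 : 5 * m + 2 <= N2 by rewrite N2E leq_pmull.
have o2E' : o2 = (k * (5 * m + 2) + (B - 1)) %/ B by rewrite o2E N2E subn1.
have lenE : X + 2 + o1 - X + o2 = 2 + o1 + o2 by genlia.
apply: wp_seq; asg_with w0; rewrite -o2E' lenE.
apply: wp_seq; asg_with w0.
apply: wp_seq; apply: wp_mono.
  apply: (@wp_copy_down w M R w0 MW W_big) => //; first by genlia.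
  by move=> a; rewrite mmX LCF_input_lt.
move=> c1 rho1 m1 [c1E -> m1E].
apply: wp_seq; asg_with w0.
apply: wp_seq; apply: wp_mono.
  by apply: (@wp_clear w M R w0 MW W_big) => //; genlia.
move=> c2 rho2 m2 [c2E -> m2E].
asg_with w0; split=> //; first by genlia.
have size_out : size (LCF_input S1 S2) = 2 + o1 + o2.
  rewrite /LCF_input lg_strings [size (_ :: _)]/= size_cat !size_pack.
  by rewrite size_S1 size_S2 -o1E -o2E !addSn add0n.
move=> a; rewrite m2E m1E; case: (ltnP a (2 + o1 + o2)) => ao.
  by rewrite /= mmX.
case: ltnP => aX /=; first by rewrite nth_default // size_out.
(* Beyond the cleared range, a lies past the end of the original instance at X, where [mmX] already
   gives 0. *)
rewrite (_ : a = X + (a - X)); last by rewrite subnKC; genlia.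
rewrite mmX !nth_default ?size_out //; genlia.
Qed.

(** Pointwise equality of memories is all that [exec_local] asks for when the algorithm takes
    over. *)
Lemma wp_build :
  wp (build R) 0 (nseq 20 0) (nth 0 inp) (fun c' rho' m' =>
    [/\ c' <= 15 * (500 * M), m' =1 nth 0 (LCF_input S1 S2),
       18 < size rho' & nth 0 rho' 18 = 5 * m + 1]).
Proof.
have [W1 MW W_big Bw] := word_bounds.
have [h0 hB Bh] := h_bounds; have bB := b_le_B.
have w0 : 0 < w by genlia.
have hh : h < 2 ^ h by exact: ltn_expl.
apply: wp_seq; apply: (wp_mono wp_load_parameters) => c1 rho1 m1 [c1E -> ->].
apply: wp_seq; apply: wp_mono.
  apply: (@wp_fill_table w M R w0 MW W_big) => //; try genlia.
  by move=> z; rewrite nth_default // size_inp leq_addr.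
move=> c2 rho2 m2 [c2E -> m2_inp m2_tab m2_0].
apply: wp_seq; apply: (wp_mono (wp_write_strings _ m2_inp m2_tab m2_0)).
move=> c3 rho3 m3 [c3E m3X [p [src [rem [x [len [l [v [u ->]]]]]]]]].
apply: (wp_mono (@wp_relocate c3 m3 p src rem x len l v u m3X)).
move=> c4 rho4 m4 [c4E m4E sz thr]; split=> //.
have kc : k <= k * cm by rewrite leq_pmulr // divn_gt0 ?b_gt0 //; move: b_gt0; genlia.
genlia.
Qed.

End Build.

(** * Lower bound on LCF algorithms *)

Lemma LCF_zeros_ones n : LCF (nseq n false) (nseq n true) = 0.
Proof.
apply/eqP; rewrite -leqn0 leqNgt; apply/negP => /(leq_LCF _ _ (ltn0Sn 0)).
case=> -[|x [|? ?]] [] // _ F1 F2.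
have := mem_infix F1 (mem_head _ _); have := mem_infix F2 (mem_head _ _).
by rewrite !mem_nseq => /andP[_ /eqP->] /andP[].
Qed.

Definition one_at n i := nseq i false ++ true :: nseq (n - i.+1) false.

Lemma size_one_at n i : i < n -> size (one_at n i) = n.
Proof. by move=> lt; rewrite size_cat /= !size_nseq addnS -addSn subnKC. Qed.

Lemma LCF_one_at n i : i < n -> 0 < LCF (one_at n i) (nseq n true).
Proof.
move=> lt; apply/(leq_LCF _ _ (ltn0Sn 0)); exists [:: true]; split=> //.
  exact: (infix_infix (nseq i false) [:: true]).
by case: n lt => // n _; exact: (prefix_infix [:: true] (nseq n true)).
Qed.

(** The single 1 stands at the first position of word i, so the packed number is 2^(i b) and has one
    nonzero digit. *)
Lemma nth_pack_one_at b n i j : 0 < b -> j != i ->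
  nth 0 (pack b (one_at n (i * b))) j = nth 0 (pack b (nseq n false)) j.
Proof.
move=> b0 ji; rewrite !nth_pack // bits_nseq div0n mod0n bits_cat /= !bits_nseq.
rewrite size_nseq add0n mul1n; case: (ltnP j i) => lt.
  have -> : i * b = b + b * (i - j.+1) + b * j.
    by rewrite mulnC -{1}(subnKC lt) mulnDr mulnS addnAC.
  by rewrite [2 ^ (_ + b * j)]expnD mulnK ?expn_gt0 // expnD mulnC modnMl.
rewrite divn_small ?mod0n // ltn_exp2l // mulnC ltn_pmul2l //.
by rewrite ltn_neqAle eq_sym ji.
Qed.

(* An algorithm that skips a word of 0^n when run on (0^n, 1^n) cannot notice
   that a 1 has been put there, although this changes the output. *)
Lemma LCF_reads_everything A (Tf Sf : nat -> nat) : LCF_algorithm A Tf Sf ->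
  exists C, forall n, 0 < n ->
    (n + (lg (n + n)).-1) %/ lg (n + n) <= C * Tf n /\
    (n + (lg (n + n)).-1) %/ lg (n + n) <= C * Sf n.
Proof.
case=> d hA; have [C hC] := hA 2; exists C => n n0.
set b := lg (n + n); set q := _ %/ b; have b0 : 0 < b by [].
have run S1 : size S1 = n -> runs_within (b + d) A (LCF_input S1 (nseq n true))
    (LCF S1 (nseq n true)) (C * Tf n) (C * Sf n).
  move=> /eqP s1.
  by apply: (hC n n n (b + d) (Tuple s1) [tuple of nseq n true]) => //; lia.
have [t [tr [s [ex out tT spS]]]] := run (nseq n false) (size_nseq _ _).
have reads i : i < q -> i.+2 \in tr.
  move=> iq; apply/negPn/negP => notin.
  have ib : i * b < n.
    have : i.+1 * b <= n + b.-1 by rewrite -leq_divRL.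
    by rewrite mulSn; lia.
  have s1 := size_one_at ib.
  have [t' [tr' [s' [ex' out' _ _]]]] := run _ s1.
  have [R Rbelow] := regs_below_exists A.
  (* The bound [R.+1] is positive, so the output register 0 is among the compared ones. *)
  have [//|a atr|S' [ex2 r2 _ _]] := @exec_local _ _ _ _ _ _ R.+1
      (init (LCF_input (one_at n (i * b)) (nseq n true))) ex
      (regs_below_leq (leqnSn R) Rbelow) _ _.
    rewrite /LCF_input s1 !size_nseq; case: a atr => [|[|a]] //= atr.
    rewrite !nth_cat !size_pack s1 size_nseq -/b -/q.
    case: ifP => // aq; apply: nth_pack_one_at => //.
    by apply: contraNneq notin => <-.
  have [_ E] := exec_det ex2 ex'.
  have := LCF_one_at ib; rewrite -out' -E r2 // out LCF_zeros_ones.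
  by [].
split.
  apply: leq_trans tT; apply: leq_trans (exec_size_trace ex).
  rewrite -[q](size_iota 2); apply: uniq_leq_size (iota_uniq _ _) _ => a.
  rewrite mem_iota => /andP[a2 aq]; rewrite -(subnKC a2) add2n; apply: reads.
  by rewrite -(ltn_add2l 2) subnKC.
(* Behind the two length cells, the last word of the first string has address [q.+1]; accessing it
   alone forces space at least q. *)
case: (posnP q) => [->//|q0]; apply: leq_trans spS.
have := @leq_bigmax_seq _ tr xpredT (fun i => i.+1) _ (reads q.-1 _) isT.
by rewrite prednK // /space => h; apply: leq_trans (h (leqnn _)); lia.
Qed.

(** * Size of the reduction *)

Lemma leq_of_mul x y L : 0 < L -> x * L <= y * L -> x <= y.
Proof. by move=> L0; rewrite leq_pmul2r. Qed.

Section Size.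

Variables (a n m k b N1 N2 B h tab X o1 o2 M : nat).
Hypotheses (n_gt0 : 0 < n) (m_gt0 : 0 < m) (k_gt0 : 0 < k).
Hypotheses (ka : k * lg n <= a * n) (ma : m <= a * lg n).
Hypotheses (bE : b = lg (n + k * m)) (N1E : N1 = 5 * n + 16) (N2E : N2 = k * (5 * m + 2)).
Hypotheses (BE : B = lg (N1 + N2)) (hE : h = B %/ 5).
Hypotheses (tabE : tab = 3 + ((n + b.-1) %/ b + k * ((m + b.-1) %/ b))).
Hypotheses (XE : X = tab + 2 ^ h) (o1E : o1 = (N1 + B.-1) %/ B) (o2E : o2 = (N2 + B.-1) %/ B).
Hypotheses (ME : M = X + (2 + o1 + o2) + 4).
Local Notation L := (lg n).

(** The two Theta constants multiply: k m <= a (k lg n) <= a a n. *)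
Lemma total_le : n + k * m <= (1 + a * a) * n.
Proof.
clear -ka ma.
have : k * m <= k * (a * L) by rewrite leq_mul2l ma orbT.
have : a * (k * L) <= a * (a * n) by rewrite leq_mul2l ka orbT.
by rewrite mulnCA mulnDl mul1n -mulnA; genlia.
Qed.

Lemma strings_le : N1 + N2 <= 21 * (1 + a * a) * n.
Proof.
clear -n_gt0 m_gt0 ka ma N1E N2E.
apply: leq_trans (N_le n_gt0 m_gt0 N1E N2E) _.
by rewrite -mulnA leq_mul2l total_le orbT.
Qed.

Lemma lg_mono x y : x <= y -> lg x <= lg y.
Proof. by move=> xy; apply: leq_lg => //; apply: leq_ltn_trans xy (lt_lg _). Qed.

Lemma lg_leq x : 0 < x -> lg x <= x.
Proof. by move=> x0; apply: leq_lg => //; apply: ltn_expl. Qed.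

(** Word counts are compared after multiplication by lg n, which is at most either word length; this
    trades divisions for bit counts. *)
Lemma ceil_mul_le c x y : 0 < c -> y <= c -> (x + c.-1) %/ c * y <= x + c.
Proof.
clear.
move=> c0 yc; have le : (x + c.-1) %/ c * y <= (x + c.-1) %/ c * c by rewrite leq_mul2l yc orbT.
by have := leq_trunc_div (x + c.-1) c; move: le; genlia.
Qed.

(** Since L <= B < 10 h, L is below 10 * 2^h; and 2 h <= B - 1, so the square of 2^h is at most 2^(B
    - 1) <= N1 + N2. *)
Lemma table_le : 2 ^ h * L <= 10 * (N1 + N2).
Proof.
clear -n_gt0 BE N1E hE.
have [h0 hB Bh] := h_bounds n_gt0 N1E BE hE.
have LB : L <= B by rewrite BE; apply: lg_mono; rewrite N1E; genlia.
have L10 : L <= 10 * 2 ^ h by have := ltn_expl h (ltnSn 1); genlia.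
have : 2 ^ h * L <= 2 ^ h * (10 * 2 ^ h) by rewrite leq_mul2l L10 orbT.
move/leq_trans; apply; rewrite mulnCA leq_mul2l -expnD /=.
apply: leq_trans (_ : 2 ^ B.-1 <= _); first by rewrite leq_exp2l //; genlia.
by rewrite BE; apply: lg_le; rewrite N1E addnS.
Qed.

Lemma memory_le :
  M <= 600 * (1 + a * a) * ((n + (lg (n + n)).-1) %/ lg (n + n)).
Proof.
set q := _ %/ _.
have L0 : 0 < L by [].
(* Here lg (n + n) = L + 1, so n <= q (L + 1) <= 2 q L; this factor 2 turns the 300 below into
   600. *)
have nq : n <= 2 * q * L.
  have := ceil_mul n (ltn0Sn L); rewrite -lg_double // -/q lg_double // mulSn.
  have : q * 1 <= q * L by rewrite leq_mul2l L0 orbT.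
  by rewrite -mulnA [L * q]mulnC; genlia.
apply: (leq_of_mul L0).
pose E := (1 + a * a) * n.
have nE : n <= E by rewrite /E mulnDl mul1n leq_addr.
have aE : a * a * n <= E by rewrite /E mulnDl leq_addl.
have tE : n + k * m <= E by exact: total_le.
have NE : N1 + N2 <= 21 * E by rewrite /E mulnA; exact: strings_le.
have b0 : 0 < b by rewrite bE.
have B0 : 0 < B by rewrite BE.
have Lb : L <= b by rewrite bE; apply: lg_mono; rewrite leq_addr.
have LB : L <= B by rewrite BE; apply: lg_mono; rewrite N1E; genlia.
have Ln : L <= n by exact: lg_leq.
have b_le : b <= E by rewrite bE; apply: leq_trans (lg_leq _) tE; rewrite addn_gt0 n_gt0.
have B_le' : B <= 21 * E by rewrite BE; apply: leq_trans (lg_leq _) NE; rewrite N1E addnS.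
have t1 := ceil_mul_le n b0 Lb.
have t2 : k * ((m + b.-1) %/ b) * L <= E.
  have cm : (m + b.-1) %/ b <= a.
    rewrite -ltnS ltn_divLR // mulSn.
    have : m <= a * b by apply: leq_trans ma _; rewrite leq_mul2l Lb orbT.
    by genlia.
  apply: leq_trans (_ : a * (k * L) <= _).
    by rewrite mulnAC mulnC leq_mul2r cm orbT.
  by apply: leq_trans aE; rewrite -mulnA leq_mul2l ka orbT.
have t3 := ceil_mul_le N1 B0 LB.
have t4 := ceil_mul_le N2 B0 LB.
have t5 := table_le.
rewrite -o1E in t3; rewrite -o2E in t4.
have : M * L <= 300 * E.
  rewrite ME XE tabE !mulnDl.
  clear -t1 t2 t3 t4 t5 nE tE NE b_le B_le' Ln.
  move: t1 t2 t3 t4 t5 nE tE NE b_le B_le' Ln; clearbody E.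
  move: ((n + b.-1) %/ b * L) (k * ((m + b.-1) %/ b) * L) (o1 * L) (o2 * L) (2 ^ h * L).
  by move: (k * m) L; clear; lia.
move/leq_trans; apply; rewrite /E -!mulnA.
have : (1 + a * a) * n <= (1 + a * a) * (2 * q * L) by rewrite leq_mul2l nq orbT.
by rewrite -mulnA; move: (_ * n) => z; genlia.
Qed.

End Size.

Lemma has_tnth (T : eqType) k (D : k.-tuple T) (P : pred T) :
  has P D = [exists i : 'I_k, P (tnth D i)].
Proof.
apply/hasP/existsP => [[x /tnthP[i ->] Px]|[i Pi]]; first by exists i.
by exists (tnth D i); rewrite ?mem_tnth.
Qed.

(* k = Theta(n / log n) is stated without division, as k * log n = Theta(n). *)
Theorem mainTheorem5 (A : prog) (T_LCF S_LCF : nat -> nat)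
    (hA : LCF_algorithm A T_LCF S_LCF) :
  exists B : prog, forall a : nat, exists d C : nat,
  forall (n m k w : nat) (T : n.-tuple bool) (D : k.-tuple (m.-tuple bool)),
    0 < n -> 0 < m -> uniq D ->
    within_factor a (k * lg n) n -> within_factor a m (lg n) ->
    lg (n + k * m) + d <= w ->
    runs_within w B (DM_input T D) [exists i : 'I_k, infix (tnth D i) T]
      (C * T_LCF n) (C * S_LCF n).
Proof.
have [R0 R0A] := regs_below_exists A.
pose R := R0.+1; have RA : regs_below R A := regs_below_leq (leqnSn R0) R0A.
have [C0 low] := LCF_reads_everything hA.
have [dA hC] := hA.
(* The program is fixed before [a], since [build] computes every parameter from the input. The
   threshold 5 m + 1 waits in a register that A cannot touch, and the last instruction compares it
   with the LCF. *)
exists (Seq (build R) (Seq A (Op Ltn 0 (R + rthr) 0))) => a.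
have [C1 run] := hC (21 * (1 + a * a)).
pose K := 15 * (500 * (600 * (1 + a * a))).
(* Eight extra bits suit [build] and exceed the five by which the encoded word length may grow for
   A. The terms [K * C0], [C1] and [C0] pay for [build] through the lower bound, for A, and for the
   final comparison. *)
exists (dA + 8), (K * C0 + C1 + C0) => n m k w T D n_gt0 m_gt0 _ [ka nk] [ma _] wd.
have k_gt0 : 0 < k by case: k nk {T D wd ka} => //; rewrite mul0n muln0 leqn0 gtn_eqF.
have wb : lg (n + k * m) + 8 <= w by lia.
pose Ds := [seq tval P | P <- D].
have sD : all (fun P => size P == m) Ds.
  by apply/allP => _ /mapP[P _ ->]; rewrite size_tuple.
have kD : size Ds = k by rewrite size_map size_tuple.
have sT : size (tval T) = n by rewrite size_tuple.
pose b := lg (n + k * m); pose N1 := 5 * n + 16; pose N2 := k * (5 * m + 2).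
pose B := lg (N1 + N2); pose h := B %/ 5.
pose tab := 3 + ((n + b.-1) %/ b + k * ((m + b.-1) %/ b)); pose X := tab + 2 ^ h.
pose o1 := (N1 + B.-1) %/ B; pose o2 := (N2 + B.-1) %/ B.
pose M := X + (2 + o1 + o2) + 4.
have M_le : M <= 600 * (1 + a * a) * ((n + (lg (n + n)).-1) %/ lg (n + n)).
  by apply: (@memory_le a n m k b N1 N2 B h tab X o1 o2 M).
have M_gt0 : 0 < M by rewrite /M addnS.
have N_le' : N1 + N2 <= 21 * (1 + a * a) * n by apply: (@strings_le a n m k).
have B_le' : B <= b + 5 by apply: (@B_le n m k).
set S1 := wrap T ++ nseq 14 false; set S2 := flatten [seq wrap P | P <- Ds].
have sS1 : size S1 = N1 by apply: size_S1 sT _.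
have sS2 : size S2 = N2 by apply: size_S2 sD kD _.
have [t1 [tr1 [r1 [rho1 [m1 [ex1 all1 hr1 fr1]]]]]] :=
  @wp_build w R n m k T Ds b N1 N2 B h tab X o1 o2 M n_gt0 m_gt0 k_gt0 sT sD kD
    erefl erefl erefl erefl erefl erefl erefl erefl erefl erefl wb (fun=> 0)
    ltac:(by move=> i _; rewrite nth_nseq if_same).
rewrite add0n -/S1 -/S2 => -[t1_le m1E sz1 thr].
have [t2 [tr2 [s2 [ex2 out2 t2_le sp2]]]] : runs_within w A (LCF_input S1 S2)
    (LCF S1 S2) (C1 * T_LCF n) (C1 * S_LCF n).
  apply: (run n (size S1) (size S2) w (in_tuple S1) (in_tuple S2)) => //.
    by rewrite sS1 sS2.
  by rewrite sS1 sS2 -/B; move: B_le' wd; rewrite -/b; clear; lia.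
(* [build] used no register below R, so A finds them all 0 as in [init]. *)
have [i iR|c ctr|s3 [ex3 reg3 reg3' _]] := @exec_local _ _ _ _ _ _ R (State r1 m1) ex2 RA _ _.
- by rewrite /= fr1.
- by rewrite /= m1E.
have w_gt0 : 0 < w by move: wb; clear; lia.
have [lowT lowS] := low n n_gt0.
have q_gt0 : 0 < (n + (lg (n + n)).-1) %/ lg (n + n).
  by rewrite divn_gt0 //; move: n_gt0; clear; lia.
have KM_le : 15 * (500 * M) <= K * ((n + (lg (n + n)).-1) %/ lg (n + n)).
  by rewrite /K -!mulnA leq_pmul2l // leq_pmul2l // mulnA.
have KM_le' : M <= K * ((n + (lg (n + n)).-1) %/ lg (n + n)).
  by apply: leq_trans KM_le; rewrite mulnA leq_pmull.
clearbody K.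
exists (t1 + (t2 + 1)), (tr1 ++ (tr2 ++ [::])).
exists (set_reg s3 0 (binop_eval w Ltn (reg s3 (R + 18)) (reg s3 0))).
have DM_E : DM_input T D = [:: n, m, k & pack b T ++ flatten [seq pack b P | P <- Ds]].
  by rewrite /DM_input /Ds -map_comp.
split.
- apply: (@ExecSeq _ _ _ _ (State r1 m1)); first by rewrite DM_E.
  by apply: ExecSeq ex3 _; constructor.
- rewrite /= /upd eqxx (reg3 0) // out2 reg3' ?leq_addr //= hr1 // thr.
  rewrite (LCF_wrap 14 T m_gt0 sD) has_map has_tnth.
  rewrite modn_small //.
  have W1 : 1 < 2 ^ w by apply: leq_ltn_trans w_gt0 (ltn_expl w _).
  by case: ([exists i, infix (tnth D i) T]); rewrite ?W1 ?expn_gt0.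
- rewrite !(mulnDl _ _ (T_LCF n)) -addnA.
  apply: leq_add; last exact: leq_add t2_le (leq_trans q_gt0 lowT).
  apply: leq_trans t1_le _; apply: leq_trans KM_le _.
  by rewrite -mulnA leq_mul2l lowT orbT.
- rewrite cats0 /space big_cat geq_max; apply/andP; split; last first.
    by apply: leq_trans sp2 _; rewrite !(mulnDl _ _ (S_LCF n)) addnAC leq_addl.
  apply/bigmax_leqP_seq => c cin _; apply: leq_trans (allP all1 c cin) _.
  rewrite !(mulnDl _ _ (S_LCF n)) -addnA; apply: leq_trans (leq_addr _ _).
  apply: leq_trans KM_le'  _.
  by rewrite -mulnA leq_mul2l lowS orbT.
Qed.
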